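(* Let $x : M \rightarrow \mathbb{E}^{m}$ be an isometric immersion of a connected Riemannian manifold with parallel mean curvature vector. Then the Laplace transformation $\mathcal{L}: M \rightarrow L(M)$ of $x$ is homothetic if and only if $M$ is immersed as a minimal submanifold of a hypersphere of $\mathbb{E}^m$ via $x$.
   Context: Manifolds and immersions are smooth, connected and of positive dimension. $\Delta=-\operatorname{trace}\nabla^2$ is the Laplace operator of $M$, $n=\dim M$. The Laplace map is $L:M\to\mathbb{E}^m$, $L(p)=(\Delta x)(p)$, equal to $-nH(p)$ where $H=\frac1n\operatorname{trace}h$ is the mean curvature vector; the Laplace transformation $\mathcal L:M\to L(M)$ is $L$ regarded as a map onto its image. $\mathcal L$ is homothetic if there is a constant $c>0$ with $\langle dL(X),dL(Y)\rangle=c^2\langle X,Y\rangle$ for all tangent vectors $X,Y$ at a common point. ''Parallel mean curvature vector'' means $DH=0$, with $D$ the normal connection. The hypersphere may have any center and radius. *)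

(* Defs.v *)
(* The Euclidean space E^m is 'rV[R]_m with the inner
   product dotp; the (sup) norm of 'rV[R]_m is only used for its topology. *)
From HB Require Import structures.
From mathcomp Require Import all_boot all_order all_algebra.
From mathcomp Require Import all_classical all_reals all_analysis.

Set Implicit Arguments.
Unset Strict Implicit.
Unset Printing Implicit Defensive.

Import Order.TTheory GRing.Theory Num.Theory.
Import numFieldNormedType.Exports.

Local Open Scope classical_set_scope.
Local Open Scope ring_scope.

Definition dotp (R : realType) (m : nat) (v w : 'rV[R]_m) : R :=
  (v *m w^T) 0 0.

(* f is C^(k+1) on the open set U when it is differentiable on U and v |-> Df(v)
   is C^k for each fixed vector v. The values of f outside U are irrelevant. *)
Fixpoint Ck_on (R : realType) (V W : normedModType R) (k : nat)
    (U : set V) (f : V -> W) : Prop :=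
  if k is k'.+1 then
    (forall u, U u -> differentiable f u) /\
    (forall v, Ck_on k' U ('D_v f))
  else {within U, continuous f}.

Definition smooth_on (R : realType) (V W : normedModType R)
    (U : set V) (f : V -> W) : Prop :=
  forall k, Ck_on k U f.

(* param i is the inverse of the chart (dom i, chart i); it is a total function,
   meaningful on the open set chart i @` dom i only. *)
Record smooth_manifold (R : realType) (n : nat) (M : topologicalType) := {
  index : Type ;
  dom : index -> set M ;
  chart : index -> M -> 'rV[R]_n ;
  param : index -> 'rV[R]_n -> M ;
  manifold_hausdorff : hausdorff_space M ;
  manifold_second_countable : @second_countable M ;
  dom_cover : forall p, exists i, dom i p ;
  dom_open : forall i, open (dom i) ;
  chart_open : forall i, open (chart i @` dom i) ;
  chartK : forall i p, dom i p -> param i (chart i p) = p ;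
  chart_continuous : forall i, {within dom i, continuous (chart i)} ;
  param_continuous : forall i, {within chart i @` dom i, continuous (param i)} ;
  transition_smooth : forall i j,
    smooth_on (chart i @` (dom i `&` dom j)) (chart j \o param i)
}.

Definition chart_at (R : realType) (n : nat) (M : topologicalType)
    (A : smooth_manifold R n M) (p : M) : index A :=
  sval (cid (dom_cover A p)).

(* A tangent vector at p is represented, in a chart i around p, by its row
   X : 'rV[R]_n of components; X in chart i and 'd (chart j \o param i) X in
   chart j represent the same tangent vector. *)
Definition bilin (R : realType) (n : nat) (G : 'M[R]_n) (X Y : 'rV[R]_n) : R :=
  (X *m G *m Y^T) 0 0.

Record riemannian_metric (R : realType) (n : nat) (M : topologicalType)
    (A : smooth_manifold R n M) := {
  metric : index A -> 'rV[R]_n -> 'M[R]_n ;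
  metric_smooth : forall i, smooth_on (chart i @` dom i) (metric i) ;
  metric_sym : forall i p, dom i p ->
    (metric i (chart i p))^T = metric i (chart i p) ;
  metric_pos : forall i p, dom i p -> forall X : 'rV[R]_n, X != 0 ->
    0 < bilin (metric i (chart i p)) X X ;
  metric_transition : forall i j p, dom i p -> dom j p -> forall X Y : 'rV[R]_n,
    bilin (metric i (chart i p)) X Y =
    bilin (metric j (chart j p))
      ('d (chart j \o param i) (chart i p) X)
      ('d (chart j \o param i) (chart i p) Y)
}.

Section Local.
Context (R : realType) (n m : nat).
Implicit Types (G : 'rV[R]_n -> 'M[R]_n) (f : 'rV[R]_n -> 'rV[R]_m).
Implicit Types (u : 'rV[R]_n) (v : 'rV[R]_m) (b : 'I_n -> 'I_n -> 'rV[R]_m).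

Definition partial (W : normedModType R) (k : 'I_n) (f : 'rV[R]_n -> W) :
    'rV[R]_n -> W :=
  'D_(delta_mx 0 k : 'rV[R]_n) f.

Definition christoffel G u (k i j : 'I_n) : R :=
  2^-1 * \sum_(l < n) invmx (G u) k l *
    (partial i G u j l + partial j G u i l - partial l G u i j).

Definition hessian G f u (i j : 'I_n) : 'rV[R]_m :=
  partial i (partial j f) u
  - \sum_(k < n) christoffel G u k i j *: partial k f u.

Definition metric_trace G u b : 'rV[R]_m :=
  \sum_(i < n) \sum_(j < n) invmx (G u) i j *: b i j.

Definition laplacian G f u : 'rV[R]_m := - metric_trace G u (hessian G f u).

(* Orthogonal projection onto the orthogonal complement of the image of df;
   G must be the metric induced by f. *)
Definition normal_part G f u v : 'rV[R]_m :=
  v - \sum_(i < n) \sum_(j < n)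
        (invmx (G u) i j * dotp v (partial i f u)) *: partial j f u.

Definition second_fundamental_form G f u (i j : 'I_n) : 'rV[R]_m :=
  normal_part G f u (partial i (partial j f) u).

Definition mean_curvature G f u : 'rV[R]_m :=
  n%:R^-1 *: metric_trace G u (second_fundamental_form G f u).

Definition hypersphere (a : 'rV[R]_m) (r : R) : set 'rV[R]_m :=
  [set y | dotp (y - a) (y - a) = r ^+ 2].

(* Orthogonal projection onto the tangent space at y of the hypersphere of
   center a through y; the Levi-Civita connection of the hypersphere is the
   flat connection followed by this projection. *)
Definition sphere_tangent_part (a y v : 'rV[R]_m) : 'rV[R]_m :=
  v - (dotp v (y - a) / dotp (y - a) (y - a)) *: (y - a).

Definition sphere_second_fundamental_form (a : 'rV[R]_m) G f u (i j : 'I_n) :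
    'rV[R]_m :=
  normal_part G f u (sphere_tangent_part a (f u) (partial i (partial j f) u)).

Definition sphere_mean_curvature (a : 'rV[R]_m) G f u : 'rV[R]_m :=
  n%:R^-1 *: metric_trace G u (sphere_second_fundamental_form a G f u).

End Local.

Section Immersion.
Context (R : realType) (n m : nat) (M : topologicalType).
Context (A : smooth_manifold R n M) (g : riemannian_metric A).
Implicit Types (x F : M -> 'rV[R]_m).

Definition smooth_map F : Prop :=
  forall i : index A, smooth_on (chart i @` dom i) (F \o param i).

Definition tangent_map F (i : index A) (p : M) (X : 'rV[R]_n) : 'rV[R]_m :=
  'd (F \o param i) (chart i p) X.

Definition immersion F : Prop :=
  smooth_map F /\
  forall (i : index A) p, dom i p -> injective (tangent_map F i p).

Definition isometric_immersion x : Prop :=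
  immersion x /\
  forall (i : index A) p, dom i p -> forall X Y : 'rV[R]_n,
    dotp (tangent_map x i p X) (tangent_map x i p Y) =
    bilin (metric g i (chart i p)) X Y.

(* The Laplacian and the mean curvature vectors are independent of the chart
   around p used to compute them. *)
Definition laplace_map x (p : M) : 'rV[R]_m :=
  let i := chart_at A p in
  laplacian (metric g i) (x \o param i) (chart i p).

Definition mean_curvature_vector x (p : M) : 'rV[R]_m :=
  let i := chart_at A p in
  mean_curvature (metric g i) (x \o param i) (chart i p).

(* The normal connection is the normal part of the flat derivative. *)
Definition parallel_mean_curvature_vector x : Prop :=
  forall (i : index A) p, dom i p -> forall X : 'rV[R]_n,
    normal_part (metric g i) (x \o param i) (chart i p)
      (tangent_map (mean_curvature_vector x) i p X) = 0.

Definition homothetic F : Prop :=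
  exists2 c : R, 0 < c &
  forall (i : index A) p, dom i p -> forall X Y : 'rV[R]_n,
    dotp (tangent_map F i p X) (tangent_map F i p Y) =
    c ^+ 2 * bilin (metric g i (chart i p)) X Y.

Definition minimal_in_hypersphere x (a : 'rV[R]_m) (r : R) : Prop :=
  (forall p, hypersphere a r (x p)) /\
  forall p, let i := chart_at A p in
    sphere_mean_curvature a (metric g i) (x \o param i) (chart i p) = 0.

End Immersion.

(* Main.v *)
Require Import Defs.
From mathcomp Require Import all_boot all_order all_algebra.
From mathcomp Require Import all_classical all_reals all_analysis.
From mathcomp Require Import ring.

(* Proof. If [H] is parallel then [dH] is tangent, and [<dH X, dx Y> =
   - <H, D^2 x(X, Y)>] is symmetric. If moreover [L = - n H] is homothetic with
   ratio [c] and [lam = c / n], then [<dH X, dH Y> = lam^2 <X, Y>], so that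
   [dH = dx o B] with [B^2 = lam^2]. The maps [y = x + H / lam] and
   [z = x - H / lam] satisfy [<dy X, dz Y> = 0], and [ker dy + ker dz] is the
   whole tangent space. Differentiating this identity, the expressions
   [<D^2 y, dz>] and [<D^2 y, D^2 z>] turn out to be totally symmetric; as they
   vanish when some argument is in [ker dy] or [ker dz], they are zero. Hence
   the traces [W], [W'] of the normal parts of [D^2 y], [D^2 z] are orthogonal
   and [2 n H = W + W'], whence [<W, H> >= 0]. On the other hand
   [<D^2 y (X, Y), H> = - <dy Y, dH X>] and [dH = lam (dy - dz) / 2] give
   [<W, H> = - (lam / 2) tr <dy, dy>]. Therefore [dy = 0], i.e.
   [x + H / lam] is a constant [a], and [x - a = - H / lam] forces
   [|x - a|^2 = 1 / lam] and the minimality of [x] in this sphere.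
   The converse holds because minimality in a sphere of center [a] and radius
   [r] means [H = - (x - a) / r^2]. *)

Set Implicit Arguments.
Unset Strict Implicit.
Unset Printing Implicit Defensive.

Import Order.TTheory GRing.Theory Num.Theory.
Import numFieldNormedType.Exports.

Local Open Scope classical_set_scope.
Local Open Scope ring_scope.

(** * Directional derivatives and the mean value theorem *)

Section DirectionalDerivatives.
Context (R : realType) (V W : normedModType R).
Implicit Types (f : V -> W) (u v w : V) (U : set V).

Lemma open_near_eq_derive U f g u v : open U -> U u ->
  (forall x, U x -> f x = g x) -> 'D_v f u = 'D_v g u.
Proof.
move=> oU Uu fg; apply: near_eq_derive.
near=> x; apply: fg; near: x; exact: open_nbhs_nbhs.
Unshelve. all: by end_near. Qed.

(** The first-order expansion of [f] at [u] is also one of [g], since the two maps have the same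
    germ there; uniqueness of the differential then identifies ['d g u] with ['d f u]. *)
Lemma near_eq_differentiable f g u :
  (\near u, f u = g u) -> differentiable f u -> differentiable g u.
Proof.
move=> fg df.
have dg : g \o shift u = cst (g u) + 'd f u +o_ 0 id.
  apply/eqaddoP => e e0; rewrite -(nbhs_singleton fg).
  have /eqaddoP/(_ e e0) H := diff_locally df.
  move: (fg); rewrite (near_shift 0 u) subr0 => fg0.
  near=> x.
  have <- : (f \o shift u - (cst (f u) + 'd f u)) x =
         (g \o shift u - (cst (f u) + 'd f u)) x.
    rewrite -[LHS]/(f (x + u) - _) -[RHS]/(g (x + u) - _); congr (_ - _).
    by near: x.
  by near: x.
apply/diff_locallyP.
have -> : 'd g u = 'd f u :> (V -> W).
  by apply: diff_unique => //; exact: diff_continuous.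
by split => //; exact: diff_continuous.
Unshelve. all: by end_near. Qed.

Lemma derive_addv f u v w : differentiable f u ->
  'D_(v + w) f u = 'D_v f u + 'D_w f u.
Proof. by move=> df; rewrite !deriveE// linearD. Qed.

Lemma derive_scalev f u (k : R) v : differentiable f u ->
  'D_(k *: v) f u = k *: 'D_v f u.
Proof. by move=> df; rewrite !deriveE// linearZ. Qed.

Lemma derive_sumv f u (I : finType) (F : I -> V) : differentiable f u ->
  'D_(\sum_i F i) f u = \sum_i 'D_(F i) f u.
Proof.
move=> df; rewrite !deriveE// linear_sum; apply: eq_bigr => i _.
by rewrite deriveE.
Qed.

(** Chain rule with the affine map [s |-> u + s *: v]; it brings the mean value theorem on a segment
    down to one real variable. *)
Lemma is_derive_line f u v (t : R) : differentiable f (u + t *: v) ->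
  is_derive t 1 (fun s : R => f (u + s *: v)) ('D_v f (u + t *: v)).
Proof.
move=> df.
have Hl : is_diff t (cst u + ( *:%R^~ v : R -> V)) (0 + *:%R^~ v).
  exact: is_diffD.
have H := @is_diff_comp _ _ _ _ (fun s : R => u + s *: v) _ f _ t Hl
  (differentiableP df).
have dl : differentiable (fun s : R => f (u + s *: v)) t by case: H.
apply: DeriveDef; first exact: diff_derivable.
by rewrite deriveE// (@diff_val _ _ _ _ _ _ _ H) add0r /= scale1r deriveE.
Qed.

End DirectionalDerivatives.

Lemma mean_value_segment (R : realType) (V : normedModType R) (f : V -> R) u v :
  (forall t, 0 <= t <= 1 -> differentiable f (u + t *: v)) ->
  exists2 t, 0 <= t <= 1 & f (u + v) - f u = 'D_v f (u + t *: v).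
Proof.
move=> df.
have [||t] := @MVT_segment R (fun s : R => f (u + s *: v))
    (fun s : R => 'D_v f (u + s *: v)) 0 1 ler01.
- move=> t /[!in_itv]/= /andP[t0 t1]; apply: is_derive_line.
  by apply: df; rewrite !ltW.
- apply: derivable_within_continuous => t /[!in_itv]/= t01.
  by have [] := is_derive_line (df t t01).
rewrite in_itv/= => t01; rewrite scale1r scale0r addr0 subr0 mulr1.
by exists t.
Qed.

(** * Symmetry of second derivatives *)

Section ScalarSchwarz.
Context (R : realType) (V : normedModType R).
Implicit Types (f : V -> R) (u v w : V) (U : set V).

Lemma derive_translate (W : normedModType R) (f : V -> W) u v w :
  'D_v (fun x => f (x + w)) u = 'D_v f (u + w).
Proof. by rewrite /derive /=; under eq_fun do rewrite -addrA. Qed.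

Lemma differentiable_translate (W : normedModType R) (f : V -> W) u w :
  differentiable f (u + w) -> differentiable (fun x => f (x + w)) u.
Proof.
move=> df; apply: (@differentiable_comp _ _ _ _ (fun x => x + w) f).
  exact: differentiableD.
exact: df.
Qed.

(** Two uses of the mean value theorem: along [v] for the increment [g x = f (x + w) - f x], then
    along [w] for ['D_v f]. *)
Lemma second_difference f U u v w :
  (forall x, U x -> differentiable f x) ->
  (forall x, U x -> differentiable ('D_v f) x) ->
  (forall s t, 0 <= s <= 1 -> 0 <= t <= 1 -> U (u + s *: v + t *: w)) ->
  exists s t, [/\ 0 <= s <= 1, 0 <= t <= 1 &
    f (u + v + w) - f (u + v) - (f (u + w) - f u) =
    'D_w ('D_v f) (u + s *: v + t *: w)].
Proof.
move=> df ddf UU.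
pose g x := f (x + w) - f x.
have dfw s : 0 <= s <= 1 -> differentiable f (u + s *: v + w).
  move=> s01; apply: df; rewrite -[w]scale1r.
  by apply: UU; rewrite // lexx ler01.
have df0 s : 0 <= s <= 1 -> differentiable f (u + s *: v).
  by move=> s01; apply: df; have := UU s 0; rewrite scale0r addr0; apply => //;
    rewrite lexx ler01.
have [|s s01 gs] := @mean_value_segment _ _ g u v.
  move=> s s01; apply: differentiableB; last exact: df0.
  exact/differentiable_translate/dfw.
have [|t t01 ht] := @mean_value_segment _ _ ('D_v f) (u + s *: v) w.
  by move=> t t01; apply: ddf; exact: UU.
exists s, t; split => //; rewrite -ht -/(g (u + v)) -/(g u) gs.
rewrite /g deriveB; first by rewrite derive_translate.
- exact/diff_derivable/differentiable_translate/dfw.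
- exact/diff_derivable/df0.
Qed.

(** A gap between [p u] and [q u] would, by continuity, keep the values of [p] and [q] near [u] more
    than zero apart; [e] is half of that gap. *)
Lemma eq_at_of_near_values (p q : V -> R) u :
  {for u, continuous p} -> {for u, continuous q} ->
  (forall r, 0 < r -> exists x y, [/\ ball u r x, ball u r y & p x = q y]) ->
  p u = q u.
Proof.
move=> cp cq pq; apply/eqP/negPn/negP => neq.
pose e := `|p u - q u| / 2.
have e0 : 0 < e by rewrite divr_gt0// normr_gt0 subr_eq0.
move/cvgrPdist_lt/(_ _ e0) : cp => cp; move/cvgrPdist_lt/(_ _ e0) : cq => cq.
have : nbhs u ([set x | `|p u - p x| < e] `&` [set x | `|q u - q x| < e]).
  exact: filterI.
move=> /nbhs_ballP[r /= r0 rP].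
have [x [y [/rP[px _] /rP[_ qy] pxy]]] := pq _ r0.
suff : `|p u - q u| < e + e by rewrite -splitr ltxx.
by rewrite -(subrKA (p x)) (le_lt_trans (ler_normD _ _))// ltrD// pxy distrC.
Qed.

Lemma small_parallelogram u v w (r : R) : 0 < r ->
  exists2 h : R, 0 < h & forall s t, 0 <= s <= 1 -> 0 <= t <= 1 ->
    ball u r (u + s *: (h *: v) + t *: (h *: w)).
Proof.
move=> r0.
have vw0 : 0 < `|v| + `|w| + 1 by rewrite ltr_wpDl// addr_ge0.
(* The summand 1 keeps the divisor positive when [v = w = 0]. *)
have [h h0 hvw] : exists2 h, 0 < h & h * (`|v| + `|w| + 1) = r / 2.
  exists (r / 2 / (`|v| + `|w| + 1)); first by rewrite !divr_gt0.
  by rewrite divfK// gt_eqF.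
exists h => // s t /andP[s0 s1] /andP[t0 t1].
rewrite -ball_normE /ball_/= opprD addrA opprD addrA subrr add0r -opprD normrN.
apply: (le_lt_trans (ler_normD _ _)); rewrite !normrZ.
rewrite (ger0_norm s0) (ger0_norm t0) (gtr0_norm h0).
apply: (@le_lt_trans _ _ (h * `|v| + h * `|w|)).
  by apply: lerD; rewrite ler_piMl// mulr_ge0// ltW.
rewrite -mulrDr (@lt_trans _ _ (r / 2))//; last first.
  by rewrite ltr_pdivrMr// ltr_pMr// ltr1n.
by rewrite -hvw ltr_pM2l// ltrDl.
Qed.

Lemma derive2_scalev f U a b (h : R) x : open U -> U x ->
  (forall x, U x -> differentiable f x) ->
  (forall x, U x -> differentiable ('D_b f) x) ->
  'D_(h *: a) ('D_(h *: b) f) x = h ^+ 2 * 'D_a ('D_b f) x.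
Proof.
move=> oU Ux df ddf.
rewrite (@open_near_eq_derive _ _ _ U _ (h *: 'D_b f))//; last first.
  by move=> y Uy; rewrite derive_scalev//; exact: df.
rewrite deriveZ; last exact/diff_derivable/ddf.
rewrite derive_scalev; last exact: ddf.
by rewrite expr2 -[RHS]mulrA.
Qed.

(** The second difference of [f] over the parallelogram with sides [h *: v] and [h *: w] is
    symmetric in [v] and [w]. It equals [h ^+ 2] times either mixed derivative, each taken at some
    point of the parallelogram; as these points can be found arbitrarily close to [u], continuity
    concludes. *)
Lemma schwarz_scalar f U u v w : open U -> U u -> Ck_on 2 U f ->
  'D_v ('D_w f) u = 'D_w ('D_v f) u.
Proof.
move=> oU Uu [df Hf].
have ddf a x : U x -> differentiable ('D_a f) x.
  by have [H _] := Hf a; exact: H.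
have cf a b : {for u, continuous ('D_a ('D_b f))}.
  have [_ /(_ a) /=] := Hf b.
  by rewrite continuous_open_subspace// => /(_ u); apply; rewrite inE.
apply: (@eq_at_of_near_values ('D_v ('D_w f)) ('D_w ('D_v f)) u
  (cf v w) (cf w v)).
move=> r r0.
have : nbhs u U by exact: open_nbhs_nbhs.
move=> /nbhs_ballP[r' /= r'0 r'U].
have [|h h0 hP] := @small_parallelogram u v w (Num.min r r').
  by rewrite lt_min r0.
have bU x : ball u (Num.min r r') x -> U x.
  by move=> ux; apply/r'U/(le_ball _ ux); rewrite ge_min lexx orbT.
have br x : ball u (Num.min r r') x -> ball u r x.
  by move=> ux; apply/(le_ball _ ux); rewrite ge_min lexx.
have hP' s t : 0 <= s <= 1 -> 0 <= t <= 1 ->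
    ball u (Num.min r r') (u + s *: (h *: w) + t *: (h *: v)).
  by move=> ? ?; rewrite addrAC; exact: hP.
have [|s [t [s01 t01 st]]] := @second_difference f U u (h *: v) (h *: w) df
  (ddf (h *: v)).
  by move=> s t s01 t01; apply/bU/hP.
have [|s' [t' [s'01 t'01 st']]] := @second_difference f U u (h *: w) (h *: v) df
  (ddf (h *: w)).
  by move=> s' t' s'01 t'01; apply/bU/hP'.
exists (u + s' *: (h *: w) + t' *: (h *: v)).
exists (u + s *: (h *: v) + t *: (h *: w)).
split; [exact/br/hP'|exact/br/hP|].
have h2 : h ^+ 2 != 0 by rewrite expf_neq0// gt_eqF.
have E1 := @derive2_scalev f U v w h _ oU (bU _ (hP' _ _ s'01 t'01)) df (ddf w).
have E2 := @derive2_scalev f U w v h _ oU (bU _ (hP _ _ s01 t01)) df (ddf v).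
apply: (mulfI h2); apply: (etrans (etrans (esym E1) (esym st'))).
apply: (etrans _ (etrans st E2)); rewrite (addrAC u (h *: w)).
by rewrite opprB opprB addrACA [in RHS]addrACA (addrC (- _)).
Qed.

End ScalarSchwarz.

(** * Functions of class C^k *)

(* Otherwise failing comparisons of derivatives are very slow. *)
Local Opaque derive diff.

Section CkCalculus.
Context (R : realType) (V : normedModType R) (U : set V) (oU : open U).
Implicit Types (W : normedModType R) (h : V -> R) (k : nat).

Lemma continuous_on_openP W (f : V -> W) :
  {within U, continuous f} <-> forall u, U u -> {for u, continuous f}.
Proof.
rewrite continuous_open_subspace//; split => H u.
  by move=> Uu; apply: H; rewrite inE.
by rewrite inE => /H.
Qed.

(** On an open set, continuity and derivatives are local. This lets derivatives be replaced by
    formulas that hold on [U] only. *)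
Lemma eq_Ck_on W (f g : V -> W) k : (forall u, U u -> f u = g u) ->
  Ck_on k U f -> Ck_on k U g.
Proof.
elim: k f g => [|k IH] f g fg /=.
  move=> /continuous_on_openP cf; apply/continuous_on_openP => u Uu.
  rewrite /prop_for /continuous_at -(fg u Uu); apply: cvg_trans (cf u Uu).
  have nU : nbhs u U by exact: open_nbhs_nbhs.
  by apply: near_eq_cvg; apply: filterS nU => x Ux; exact: fg.
move=> [df Df]; split => [u Uu|v].
  apply: near_eq_differentiable (df u Uu).
  have nU : nbhs u U by exact: open_nbhs_nbhs.
  by apply: filterS nU => x Ux; exact: fg.
by apply: IH (Df v) => u Uu; exact: open_near_eq_derive fg.
Qed.

Lemma Ck_onW W (f : V -> W) k : Ck_on k.+1 U f -> Ck_on k U f.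
Proof.
elim: k f => [|k IH] f /= [df Df].
  by apply/continuous_on_openP => u /df; exact: differentiable_continuous.
by split => // v; apply: IH; exact: Df.
Qed.

Lemma Ck_on_cst W (a : W) k : Ck_on k U (fun=> a).
Proof.
elim: k a => [|k IH] a /=.
  by apply/continuous_on_openP => u _; exact: cvg_cst.
split=> [u _|v]; first exact: differentiable_cst.
rewrite (_ : 'D_v _ = fun=> 0); first exact: IH.
by apply/funext => u; rewrite derive_cst.
Qed.

Lemma Ck_onD W (f g : V -> W) k :
  Ck_on k U f -> Ck_on k U g -> Ck_on k U (fun u => f u + g u).
Proof.
elim: k f g => [|k IH] f g /=.
  move=> /continuous_on_openP cf /continuous_on_openP cg.
  by apply/continuous_on_openP => u Uu; apply: cvgD; [exact: cf|exact: cg].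
move=> [df Df] [dg Dg]; split=> [u Uu|v].
  by apply: differentiableD; [exact: df|exact: dg].
apply: eq_Ck_on (IH _ _ (Df v) (Dg v)) => u Uu.
by rewrite deriveD//; apply: diff_derivable; [exact: df|exact: dg].
Qed.

Lemma Ck_onZ W (f : V -> W) (a : R) k :
  Ck_on k U f -> Ck_on k U (fun u => a *: f u).
Proof.
elim: k f => [|k IH] f /=.
  move=> /continuous_on_openP cf.
  apply/continuous_on_openP => u Uu.
  by apply: continuousZ (cf u Uu); exact: cvg_cst.
move=> [df Df]; split=> [u Uu|v].
  by apply: differentiableZ; exact: df.
apply: eq_Ck_on (IH _ (Df v)) => u Uu.
by rewrite deriveZ//; exact/diff_derivable/df.
Qed.

Lemma Ck_onM h1 h2 k :
  Ck_on k U h1 -> Ck_on k U h2 -> Ck_on k U (fun u => h1 u * h2 u).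
Proof.
elim: k h1 h2 => [|k IH] h1 h2.
  move=> /continuous_on_openP c1 /continuous_on_openP c2.
  by apply/continuous_on_openP => u Uu; apply: cvgM; [exact: c1|exact: c2].
move=> C1 C2; have [d1 D1] := C1; have [d2 D2] := C2; split=> [u Uu|v].
  by apply: differentiableM; [exact: d1|exact: d2].
apply: eq_Ck_on
  (Ck_onD (IH _ _ (Ck_onW C1) (D2 v)) (IH _ _ (Ck_onW C2) (D1 v))).
by move=> u Uu; rewrite deriveM//; apply: diff_derivable; [exact: d1|exact: d2].
Qed.

(** Induction on [k]: the derivative of the inverse is [- h ^- 2] times that of [h], and the inverse
    is already known to be of the lower class. *)
Lemma Ck_on_inv h k : (forall u, U u -> h u != 0) ->
  Ck_on k U h -> Ck_on k U (fun u => (h u)^-1).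
Proof.
move=> h0; elim: k => [|k IH].
  move=> /continuous_on_openP ch.
  by apply/continuous_on_openP => u Uu; apply: cvgV; [exact: h0|exact: ch].
move=> Ch; have [dh Dh] := Ch; split=> [u Uu|v].
  by apply: differentiableV; [exact: dh|exact: h0].
have Ci := IH (Ck_onW Ch).
apply: eq_Ck_on (Ck_onZ (-1) (Ck_onM (Ck_onM Ci Ci) (Dh v))) => u Uu.
rewrite deriveV ?h0//; last exact/diff_derivable/dh.
by rewrite scaleN1r scaleNr -expr2 exprVn.
Qed.

Lemma Ck_on_sum W (I : Type) (s : seq I) (P : pred I) (F : I -> V -> W) k :
  (forall i, Ck_on k U (F i)) ->
  Ck_on k U (fun u => \sum_(i <- s | P i) F i u).
Proof.
move=> CF; elim: s => [|i s IH].
  by under [X in Ck_on _ _ X]eq_fun do rewrite big_nil; exact: Ck_on_cst.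
under [X in Ck_on _ _ X]eq_fun do rewrite big_cons.
by case: (P i) => //; exact: Ck_onD.
Qed.

Lemma Ck_on_prod (I : Type) (s : seq I) (P : pred I) (F : I -> V -> R) k :
  (forall i, Ck_on k U (F i)) ->
  Ck_on k U (fun u => \prod_(i <- s | P i) F i u).
Proof.
move=> CF; elim: s => [|i s IH].
  by under [X in Ck_on _ _ X]eq_fun do rewrite big_nil; exact: Ck_on_cst.
under [X in Ck_on _ _ X]eq_fun do rewrite big_cons.
by case: (P i) => //; exact: Ck_onM.
Qed.

(** * Reduction of regularity of matrix-valued maps to their entries *)

Section Matrices.
Context (p q : nat).
Implicit Types F : V -> 'M[R]_(p, q).

Lemma mx_differentiableP F u :
  (forall i j, differentiable (fun x => F x i j) u) -> differentiable F u.
Proof.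
move=> dF; rewrite (_ : F = \sum_(ij : 'I_p * 'I_q)
    (fun x => F x ij.1 ij.2 *: delta_mx ij.1 ij.2)); last first.
  apply/funext => x; rewrite [LHS]matrix_sum_delta pair_big fct_sumE.
  by apply: eq_bigr => -[].
elim/big_ind : _ => [|f g df dg|ij _]; first exact: differentiable_cst.
  exact: differentiableD.
exact: differentiableZl.
Qed.

Lemma differentiable_mx_coord F u i j :
  differentiable F u -> differentiable (fun x => F x i j) u.
Proof.
move=> dF; apply: (@differentiable_comp _ _ _ _ F (fun M => M i j)) => //.
exact: differentiable_coord.
Qed.

Lemma derive_mx_coord F u v i j : derivable F u v ->
  'D_v (fun x => F x i j) u = 'D_v F u i j.
Proof. by move=> dF; rewrite derive_mx// mxE. Qed.

Lemma Ck_on_mxP F k :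
  Ck_on k U F <-> forall i j, Ck_on k U (fun u => F u i j).
Proof.
elim: k F => [|k IH] F.
  split=> [/continuous_on_openP cF i j|cF].
    apply/continuous_on_openP => u Uu.
    apply: (@continuous_comp _ _ _ F (fun M : 'M[R]_(p, q) => M i j)).
      exact: cF.
    exact: coord_continuous.
  apply/continuous_on_openP => u Uu.
  have cFij i j : {for u, continuous (fun x => F x i j)}.
    by have /continuous_on_openP := cF i j; apply.
  apply/cvgrPdist_lt => e e0.
  (* There are finitely many entries, so one neighbourhood serves them all; the norm of a matrix is
     the largest absolute value of an entry. *)
  have : \forall x \near u, (forall ij : 'I_p * 'I_q,
      `|F u ij.1 ij.2 - F x ij.1 ij.2| < e).
    apply: filter_forall => ij.
    by have /cvgrPdist_lt := cFij ij.1 ij.2; apply.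
  apply: filterS => x xe.
  rewrite [ltLHS]/Num.Def.normr/= mx_normrE; apply/bigmax_ltP; split => // ij _.
  by rewrite !mxE.
split=> [[dF DF] i j|CF].
  split=> [u Uu|v]; first exact/differentiable_mx_coord/dF.
  have /IH/(_ i j) := DF v; apply: eq_Ck_on => u Uu.
  by rewrite derive_mx_coord//; exact/diff_derivable/dF.
have dF u : U u -> differentiable F u.
  by move=> Uu; apply: mx_differentiableP => i j; have [+ _] := CF i j; apply.
split=> // v; apply/IH => i j.
have [_ /(_ v)] := CF i j; apply: eq_Ck_on => u Uu.
by rewrite derive_mx_coord//; exact/diff_derivable/dF.
Qed.

End Matrices.

Lemma Ck_on_det n (F : V -> 'M[R]_n) k :
  (forall i j, Ck_on k U (fun u => F u i j)) ->
  Ck_on k U (fun u => \det (F u)).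
Proof.
move=> CF; apply: Ck_on_sum => s.
by apply: Ck_onM; [exact: Ck_on_cst|apply: Ck_on_prod => i; exact: CF].
Qed.

(** Cramer's rule: the entries of the inverse are cofactors divided by a determinant that does not
    vanish on [U]. *)
Lemma Ck_on_invmx n (F : V -> 'M[R]_n) k :
  (forall u, U u -> F u \in unitmx) -> 
  (forall i j, Ck_on k U (fun u => F u i j)) ->
  forall i j, Ck_on k U (fun u => invmx (F u) i j).
Proof.
move=> unitF CF i j.
apply: (@eq_Ck_on _ (fun u => (\det (F u))^-1 * cofactor (F u) j i)).
  by move=> u Uu; rewrite /invmx unitF// !mxE.
apply: Ck_onM.
  apply: Ck_on_inv; last exact: Ck_on_det.
  by move=> u /unitF; rewrite unitmxE unitfE.
apply: Ck_onM; first exact: Ck_on_cst.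
apply: Ck_on_det => i' j'.
by apply: eq_Ck_on (CF (lift j i') (lift i j')) => u _; rewrite !mxE.
Qed.

Lemma smooth_differentiable W (f : V -> W) u :
  smooth_on U f -> U u -> differentiable f u.
Proof. by move=> /(_ 1%N)[df _] /df. Qed.

Lemma smooth_derivable W (f : V -> W) u v :
  smooth_on U f -> U u -> derivable f u v.
Proof. by move=> sf Uu; exact/diff_derivable/smooth_differentiable. Qed.

Lemma smooth_derive W (f : V -> W) v : smooth_on U f -> smooth_on U ('D_v f).
Proof. by move=> sf k; have [_] := sf k.+1; apply. Qed.

Lemma schwarz p q (F : V -> 'M[R]_(p, q)) u v w : smooth_on U F -> U u ->
  'D_v ('D_w F) u = 'D_w ('D_v F) u.
Proof.
move=> sF Uu.
have coordE a b i j : 'D_a ('D_b F) u i j = 'D_a ('D_b (fun x => F x i j)) u.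
  rewrite -derive_mx_coord; last exact/smooth_derivable/Uu/smooth_derive.
  apply: (open_near_eq_derive _ oU Uu) => x Ux; rewrite derive_mx_coord//.
  exact: smooth_derivable Ux.
apply/matrixP => i j.
apply: (etrans (coordE v w i j)); apply: (etrans _ (esym (coordE w v i j))).
apply: (schwarz_scalar _ _ oU Uu).
by have /Ck_on_mxP := sF 2%N; apply.
Qed.

End CkCalculus.

(** * Inner products *)

Section DotProduct.
Context (R : realType) (m : nat).
Implicit Types (v w : 'rV[R]_m).

Lemma dotpE v w : dotp v w = \sum_k v 0 k * w 0 k.
Proof. by rewrite /dotp mxE; apply: eq_bigr => k _; rewrite mxE. Qed.

Lemma dotpC v w : dotp v w = dotp w v.
Proof. by rewrite !dotpE; apply: eq_bigr => k _; rewrite mulrC. Qed.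

Lemma dotpDl v1 v2 w : dotp (v1 + v2) w = dotp v1 w + dotp v2 w.
Proof. by rewrite /dotp mulmxDl mxE. Qed.

Lemma dotpZl a v w : dotp (a *: v) w = a * dotp v w.
Proof. by rewrite /dotp -scalemxAl mxE. Qed.

Lemma dotpNl v w : dotp (- v) w = - dotp v w.
Proof. by rewrite /dotp mulNmx mxE. Qed.

Lemma dotp0l w : dotp 0 w = 0.
Proof. by rewrite /dotp mul0mx mxE. Qed.

Lemma dotpBl v1 v2 w : dotp (v1 - v2) w = dotp v1 w - dotp v2 w.
Proof. by rewrite dotpDl dotpNl. Qed.

Lemma dotp_suml (I : Type) (s : seq I) (P : pred I) (F : I -> 'rV[R]_m) w :
  dotp (\sum_(i <- s | P i) F i) w = \sum_(i <- s | P i) dotp (F i) w.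
Proof. by rewrite /dotp mulmx_suml summxE. Qed.

Lemma dotpDr v w1 w2 : dotp v (w1 + w2) = dotp v w1 + dotp v w2.
Proof. by rewrite dotpC dotpDl !(dotpC v). Qed.

Lemma dotpZr a v w : dotp v (a *: w) = a * dotp v w.
Proof. by rewrite dotpC dotpZl dotpC. Qed.

Lemma dotpNr v w : dotp v (- w) = - dotp v w.
Proof. by rewrite dotpC dotpNl dotpC. Qed.

Lemma dotp0r v : dotp v 0 = 0.
Proof. by rewrite dotpC dotp0l. Qed.

Lemma dotpBr v w1 w2 : dotp v (w1 - w2) = dotp v w1 - dotp v w2.
Proof. by rewrite dotpDr dotpNr. Qed.

Lemma dotp_sumr (I : Type) (s : seq I) (P : pred I) (F : I -> 'rV[R]_m) v :
  dotp v (\sum_(i <- s | P i) F i) = \sum_(i <- s | P i) dotp v (F i).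
Proof. by rewrite dotpC dotp_suml; apply: eq_bigr => i _; rewrite dotpC. Qed.

Lemma dotp_ge0 v : 0 <= dotp v v.
Proof. by rewrite dotpE; apply: sumr_ge0 => k _; rewrite -expr2 sqr_ge0. Qed.

Lemma dotp_eq0 v : (dotp v v == 0) = (v == 0).
Proof.
apply/idP/eqP => [|->]; last by rewrite dotp0l.
rewrite dotpE psumr_eq0 => [/allP v0|k _]; last by rewrite -expr2 sqr_ge0.
apply/rowP => k; rewrite mxE; apply/eqP.
by have := v0 k (mem_index_enum _); rewrite -expr2 sqrf_eq0.
Qed.

Context (V : normedModType R) (U : set V) (oU : open U).
Implicit Types (f g : V -> 'rV[R]_m) (u a : V).

Lemma derive_dotp f g u a : derivable f u a -> derivable g u a ->
  'D_a (fun x => dotp (f x) (g x)) u =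
  dotp ('D_a f u) (g u) + dotp (f u) ('D_a g u).
Proof.
move=> df dg.
have dfk k : derivable (fun x => f x 0 k) u a.
  by have /derivable_mxP := df; apply.
have dgk k : derivable (fun x => g x 0 k) u a.
  by have /derivable_mxP := dg; apply.
rewrite (_ : (fun x => dotp (f x) (g x)) =
    \sum_k (fun x => f x 0 k * g x 0 k)); last first.
  by apply/funext => x; rewrite dotpE fct_sumE.
rewrite derive_sum => [|k]; last exact: derivableM.
rewrite !dotpE -big_split/=; apply: eq_bigr => k _.
rewrite (deriveM (dfk k) (dgk k)).
rewrite (derive_mx_coord 0 k df) (derive_mx_coord 0 k dg).
by rewrite addrC; congr (_ + _); exact: mulrC.
Qed.

(** Leibniz rule for a constant product. Every orthogonality relation below is differentiated in
    this form with [c = 0]; the equation of a sphere uses [c = r ^+ 2]. *)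
Lemma dotp_cst_derive f g u a (c : R) : U u ->
  (forall x, U x -> dotp (f x) (g x) = c) ->
  derivable f u a -> derivable g u a ->
  dotp ('D_a f u) (g u) = - dotp (f u) ('D_a g u).
Proof.
move=> Uu fg df dg; apply/eqP; rewrite -addr_eq0 -derive_dotp//.
by rewrite (@open_near_eq_derive _ _ _ U _ (cst c))// derive_cst.
Qed.

Lemma Ck_on_dotp f g k : Ck_on k U f -> Ck_on k U g ->
  Ck_on k U (fun x => dotp (f x) (g x)).
Proof.
move=> /(Ck_on_mxP oU) Cf /(Ck_on_mxP oU) Cg.
under [X in Ck_on _ _ X]eq_fun do rewrite dotpE.
by apply: (Ck_on_sum oU) => i; apply: Ck_onM.
Qed.

End DotProduct.

Lemma bilinE (R : realType) (n : nat) (G : 'M[R]_n) X Y :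
  bilin G X Y = \sum_i \sum_j X 0 i * G i j * Y 0 j.
Proof.
rewrite /bilin mxE exchange_big/=; apply: eq_bigr => j _.
by rewrite !mxE mulr_suml.
Qed.

Lemma bilin_delta (R : realType) (n : nat) (G : 'M[R]_n) i j :
  bilin G (delta_mx 0 i) (delta_mx 0 j) = G i j.
Proof. by rewrite /bilin -rowE trmx_delta -colE !mxE. Qed.

(** * Positive definite matrices and traces of Gram matrices *)

Section PositiveDefinite.
Context (R : realType) (n : nat) (G : 'M[R]_n).
Implicit Types X Y : 'rV[R]_n.

Hypothesis Gpos : forall X, X != 0 -> 0 < bilin G X X.

(** A vector in the kernel of [G] has [bilin G X X = 0], hence is zero. *)
Lemma posdef_unitmx : G \in unitmx.
Proof.
rewrite -row_free_unit -kermx_eq0; apply/rowV0P => X /sub_kermxP XG.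
apply/eqP/negPn/negP => /Gpos.
by rewrite /bilin XG mul0mx mxE ltxx.
Qed.

Hypothesis Gsym : G^T = G.

Lemma invmx_sym i j : invmx G i j = invmx G j i.
Proof. by rewrite -[in LHS]Gsym -trmx_inv mxE. Qed.

Lemma bilin_invmx X : bilin (invmx G) X X =
  bilin G (X *m invmx G) (X *m invmx G).
Proof.
rewrite /bilin mulmxKV ?posdef_unitmx// trmx_mul trmx_inv Gsym.
by rewrite mulmxA.
Qed.

Lemma bilin_invmx_ge0 X : 0 <= bilin (invmx G) X X.
Proof.
rewrite bilin_invmx; set Y := X *m _.
have [->|/Gpos/ltW//] := eqVneq Y 0.
by rewrite /bilin mul0mx mul0mx mxE.
Qed.

Lemma bilin_invmx_eq0 X : bilin (invmx G) X X <= 0 -> X = 0.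
Proof.
rewrite bilin_invmx => XX; have [X0|/Gpos] := eqVneq (X *m invmx G) 0.
  by rewrite -[X](mulmxKV posdef_unitmx) X0 mul0mx.
by rewrite ltNge XX.
Qed.

(** The inner product is a sum over the coordinates of the ambient space, and each coordinate [k]
    contributes one value of the quadratic form of [invmx G]. *)
Lemma gram_trace_bilin m (e : 'I_n -> 'rV[R]_m) :
  \sum_i \sum_j invmx G i j * dotp (e i) (e j) =
  \sum_k bilin (invmx G) (\row_i e i 0 k) (\row_i e i 0 k).
Proof.
under [RHS]eq_bigr do rewrite bilinE.
rewrite [RHS]exchange_big/=; apply: eq_bigr => i _.
rewrite [RHS]exchange_big/=; apply: eq_bigr => j _.
rewrite dotpE mulr_sumr; apply: eq_bigr => k _.
by rewrite !mxE; ring.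
Qed.

(** The trace is a sum of values of a positive definite form, so each of them vanishes. This turns
    the final sign estimate into the vanishing of a differential. *)
Lemma gram_trace_le0 m (e : 'I_n -> 'rV[R]_m) :
  \sum_i \sum_j invmx G i j * dotp (e i) (e j) <= 0 -> forall i, e i = 0.
Proof.
rewrite gram_trace_bilin => le0 i; apply/rowP => k; rewrite mxE.
have E : \row_i e i 0 k = 0 :> 'rV_n.
  apply: bilin_invmx_eq0; apply: le_trans le0.
  rewrite (bigD1 k)//= lerDl; apply: sumr_ge0 => j _; exact: bilin_invmx_ge0.
by have /rowP/(_ i) := E; rewrite !mxE.
Qed.

Lemma trace_invmx_self : \sum_i \sum_j invmx G i j * G i j = n%:R.
Proof.
rewrite -(mxtrace1 R n) -(mulVmx posdef_unitmx) /mxtrace.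
apply: eq_bigr => i _; rewrite mxE; apply: eq_bigr => j _.
by rewrite -[in RHS]Gsym mxE Gsym.
Qed.

End PositiveDefinite.

(** * Normal projection, second fundamental form, mean curvature *)

Local Opaque dotp mulmx invmx delta_mx.

Section NormalPart.
Context (R : realType) (n m : nat).
Context (G : 'rV[R]_n -> 'M[R]_n) (f : 'rV[R]_n -> 'rV[R]_m) (u : 'rV[R]_n).
Hypothesis df : differentiable f u.
Hypothesis fG : forall a b, dotp ('D_a f u) ('D_b f u) = bilin (G u) a b.
Hypothesis Gpos : forall X : 'rV[R]_n, X != 0 -> 0 < bilin (G u) X X.
Implicit Types (a b : 'rV[R]_n) (v w : 'rV[R]_m).

Lemma derive_partial (W : normedModType R) (h : 'rV[R]_n -> W) x a :
  differentiable h x -> 'D_a h x = \sum_i a 0 i *: partial i h x.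
Proof.
move=> dh; rewrite {1}[a]row_sum_delta derive_sumv//.
by apply: eq_bigr => i _; rewrite derive_scalev.
Qed.

Lemma metric_matrixE i j : G u i j = dotp (partial i f u) (partial j f u).
Proof. by rewrite -bilin_delta -fG. Qed.

Lemma metric_tr : (G u)^T = G u.
Proof.
apply/matrixP => i j; rewrite mxE (metric_matrixE i j) (metric_matrixE j i).
exact: dotpC.
Qed.

(** Components, in the frame of partial derivatives of [f], of the tangential projection of [v]: the
    solution [a] of [a *m G u = \row_i dotp v (partial i f u)]. *)
Definition tangent_coef v : 'rV[R]_n :=
  (\row_i dotp v (partial i f u)) *m invmx (G u).

Lemma normal_partE v : normal_part G f u v = v - 'D_(tangent_coef v) f u.
Proof.
rewrite /normal_part derive_partial// exchange_big/=; congr (_ - _).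
apply: eq_bigr => j _; rewrite -scaler_suml; congr (_ *: _).
by rewrite mxE; apply: eq_bigr => i _; rewrite mxE mulrC.
Qed.

Lemma dotp_tangent_coef v b :
  dotp ('D_(tangent_coef v) f u) ('D_b f u) = dotp v ('D_b f u).
Proof.
rewrite fG /bilin /tangent_coef mulmxKV; last exact: posdef_unitmx.
rewrite (derive_partial b df) dotp_sumr mxE; apply: eq_bigr => i _.
by rewrite !mxE dotpZr mulrC.
Qed.

Lemma normal_part_orth v b : dotp (normal_part G f u v) ('D_b f u) = 0.
Proof. by rewrite normal_partE dotpBl dotp_tangent_coef subrr. Qed.

Lemma normal_part_id v : (forall b, dotp v ('D_b f u) = 0) ->
  normal_part G f u v = v.
Proof.
move=> v0; rewrite normal_partE /tangent_coef (_ : \row_i _ = 0).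
  by rewrite mul0mx -[0](scale0r 0) derive_scalev// scale0r subr0.
by apply/rowP => i; rewrite !mxE v0.
Qed.

(** This normal part is a difference of two tangent vectors and is orthogonal to both, hence to
    itself. *)
Lemma normal_part_tangent a : normal_part G f u ('D_a f u) = 0.
Proof.
apply/eqP; rewrite -dotp_eq0 {2}normal_partE dotpBr !normal_part_orth.
by rewrite subr0.
Qed.

Lemma normal_part_eq0 v : normal_part G f u v = 0 ->
  v = 'D_(tangent_coef v) f u.
Proof. by rewrite normal_partE => /eqP; rewrite subr_eq0 => /eqP. Qed.

Lemma tangent_coefD v w :
  tangent_coef (v + w) = tangent_coef v + tangent_coef w.
Proof.
rewrite /tangent_coef -mulmxDl; congr (_ *m _).
by apply/rowP => i; rewrite !mxE dotpDl.
Qed.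

Lemma tangent_coefZ (k : R) v : tangent_coef (k *: v) = k *: tangent_coef v.
Proof.
rewrite /tangent_coef scalemxAl; congr (_ *m _).
by apply/rowP => i; rewrite !mxE dotpZl.
Qed.

Lemma normal_partD v w :
  normal_part G f u (v + w) = normal_part G f u v + normal_part G f u w.
Proof. by rewrite !normal_partE tangent_coefD derive_addv// opprD addrACA. Qed.

Lemma normal_partZ (k : R) v :
  normal_part G f u (k *: v) = k *: normal_part G f u v.
Proof. by rewrite !normal_partE tangent_coefZ derive_scalev// scalerBr. Qed.

Lemma normal_part_sum (I : finType) (F : I -> 'rV[R]_m) :
  normal_part G f u (\sum_i F i) = \sum_i normal_part G f u (F i).
Proof.
apply: (big_morph _ normal_partD).
by have := normal_partZ 0 0; rewrite !scale0r.
Qed.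

Lemma normal_partB v w :
  normal_part G f u (v - w) = normal_part G f u v - normal_part G f u w.
Proof. by rewrite -[- w]scaleN1r normal_partD normal_partZ scaleN1r. Qed.

Lemma dotp_normal_part v w :
  dotp (normal_part G f u v) (normal_part G f u w) =
  dotp (normal_part G f u v) w.
Proof. by rewrite [in LHS](normal_partE w) dotpBr normal_part_orth subr0. Qed.

Lemma dotp_normal_part_id v w : (forall b, dotp w ('D_b f u) = 0) ->
  dotp (normal_part G f u v) w = dotp v w.
Proof.
by move=> w0; rewrite normal_partE dotpBl [X in _ - X]dotpC w0 subr0.
Qed.

End NormalPart.

(** * Metric traces of vector-valued forms *)

Section MetricTrace.
Context (R : realType) (n m : nat).
Context (G : 'rV[R]_n -> 'M[R]_n) (u : 'rV[R]_n).
Implicit Types b : 'I_n -> 'I_n -> 'rV[R]_m.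

Lemma eq_metric_trace b1 b2 : (forall i j, b1 i j = b2 i j) ->
  metric_trace G u b1 = metric_trace G u b2.
Proof.
by move=> b12; apply: eq_bigr => i _; apply: eq_bigr => j _; rewrite b12.
Qed.

Lemma metric_traceD b1 b2 : metric_trace G u (fun i j => b1 i j + b2 i j) =
  metric_trace G u b1 + metric_trace G u b2.
Proof.
rewrite -big_split; apply: eq_bigr => i _; rewrite -big_split.
by apply: eq_bigr => j _; rewrite scalerDr.
Qed.

Lemma metric_traceZ (k : R) b : metric_trace G u (fun i j => k *: b i j) =
  k *: metric_trace G u b.
Proof.
rewrite scaler_sumr; apply: eq_bigr => i _; rewrite scaler_sumr.
by apply: eq_bigr => j _; rewrite !scalerA mulrC.
Qed.

Lemma dotp_metric_trace b v : dotp (metric_trace G u b) v =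
  \sum_i \sum_j invmx (G u) i j * dotp (b i j) v.
Proof.
rewrite dotp_suml; apply: eq_bigr => i _; rewrite dotp_suml.
by apply: eq_bigr => j _; rewrite dotpZl.
Qed.

Lemma dotp_metric_trace_eq0 b v : (forall i j, dotp (b i j) v = 0) ->
  dotp (metric_trace G u b) v = 0.
Proof.
move=> bv; rewrite dotp_metric_trace big1// => i _; rewrite big1// => j _.
by rewrite bv mulr0.
Qed.

End MetricTrace.

(** Here [dG p q r] stands for the derivative along [p] of the metric coefficient of indices [q],
    [r]. In the alternating sum all products cancel in pairs except two equal ones. *)
Lemma koszul_formula (R : realType) (n m : nat) (dG : 'I_n -> 'I_n -> 'I_n -> R)
    (ddf : 'I_n -> 'I_n -> 'rV[R]_m) (df : 'I_n -> 'rV[R]_m) :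
  (forall p q, ddf p q = ddf q p) ->
  (forall p q r,
    dG p q r = dotp (ddf p q) (df r) + dotp (df q) (ddf p r)) ->
  forall i j l,
    2^-1 * (dG i j l + dG j i l - dG l i j) = dotp (ddf i j) (df l).
Proof.
move=> ddfC dGE i j l.
rewrite !dGE (ddfC l i) (ddfC l j) (ddfC j i) (dotpC (df j)).
rewrite (dotpC (df i)) (dotpC (ddf i l)).
by field.
Qed.

(** * Gauss formula, Beltrami formula and smoothness of the mean curvature *)

Section SecondFundamentalForm.
Context (R : realType) (n m : nat) (n_gt0 : (0 < n)%N).
Context (U : set 'rV[R]_n) (oU : open U).
Context (G : 'rV[R]_n -> 'M[R]_n) (f : 'rV[R]_n -> 'rV[R]_m).
Hypothesis sf : smooth_on U f.
Hypothesis sG : smooth_on U G.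
Hypothesis fG : forall u, U u -> forall a b,
  dotp ('D_a f u) ('D_b f u) = bilin (G u) a b.
Hypothesis Gpos : forall u, U u -> forall X : 'rV[R]_n, X != 0 ->
  0 < bilin (G u) X X.
Implicit Types (u a b : 'rV[R]_n).

Lemma n_neq0 : n%:R != 0 :> R.
Proof. by rewrite pnatr_eq0 -lt0n. Qed.

Lemma scale_mean_curvature u : n%:R *: mean_curvature G f u =
  metric_trace G u (second_fundamental_form G f u).
Proof. by rewrite scalerA mulfV ?n_neq0// scale1r. Qed.

(** Gauss formula: by Koszul's identity the Christoffel symbols are the components of the tangential
    part of the second derivative. Hence the Hessian of an isometric immersion is its second
    fundamental form. *)
Lemma christoffel_tangent u i j : U u ->
  \sum_k christoffel G u k i j *: partial k f u =
  'D_(tangent_coef G f u (partial i (partial j f) u)) f u.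
Proof.
move=> Uu; have df := smooth_differentiable sf Uu.
rewrite (derive_partial _ df).
apply: eq_bigr => k _; congr (_ *: _).
rewrite /christoffel mulr_sumr mxE.
have Gtr := metric_tr (fG Uu).
apply: eq_bigr => l _; rewrite mxE (invmx_sym Gtr k l) mulrCA [RHS]mulrC.
congr (_ * _).
have dG p q r : partial p G u q r =
    dotp (partial p (partial q f) u) (partial r f u) +
    dotp (partial q f u) (partial p (partial r f) u).
  have sq a := smooth_derivable (smooth_derive a sf) Uu.
  rewrite -derive_dotp; [|exact: sq|exact: sq].
  rewrite -derive_mx_coord; last exact: smooth_derivable Uu.
  apply: (open_near_eq_derive _ oU Uu) => x Ux.
  exact: metric_matrixE (fG Ux) _ _.
have sw p q : partial p (partial q f) u = partial q (partial p f) u.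
  exact: (schwarz oU _ _ sf Uu).
exact: (@koszul_formula _ _ _ (fun p q r => partial p G u q r)
  (fun p q => partial p (partial q f) u) (fun r => partial r f u)).
Qed.

Lemma hessianE u i j : U u ->
  hessian G f u i j = second_fundamental_form G f u i j.
Proof.
move=> Uu; have df := smooth_differentiable sf Uu.
by rewrite /second_fundamental_form normal_partE// /hessian christoffel_tangent.
Qed.

Lemma laplacianE u : U u -> laplacian G f u = - (n%:R *: mean_curvature G f u).
Proof.
move=> Uu; rewrite scale_mean_curvature; congr (- _).
by apply: eq_metric_trace => i j; exact: hessianE.
Qed.

Lemma mean_curvature_normal u b : U u ->
  dotp (mean_curvature G f u) ('D_b f u) = 0.
Proof.
move=> Uu; rewrite dotpZl dotp_metric_trace_eq0 ?mulr0// => i j.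
apply: normal_part_orth; first exact: smooth_differentiable Uu.
- exact: fG.
- exact: Gpos.
Qed.

(** Against a normal vector [v], the normal projection in the second fundamental form may be
    dropped. *)
Lemma dotp_mean_curvature u v : U u -> (forall b, dotp v ('D_b f u) = 0) ->
  n%:R * dotp (mean_curvature G f u) v =
  \sum_i \sum_j invmx (G u) i j * dotp (partial i (partial j f) u) v.
Proof.
move=> Uu v0; rewrite -dotpZl scale_mean_curvature dotp_metric_trace.
apply: eq_bigr => i _; apply: eq_bigr => j _; congr (_ * _).
by apply: dotp_normal_part_id => //; exact: smooth_differentiable Uu.
Qed.

Lemma Ck_on_normal_part (v : 'rV[R]_n -> 'rV[R]_m) k : Ck_on k U v ->
  Ck_on k U (fun u => normal_part G f u (v u)).
Proof.
move=> Cv; apply/(Ck_on_mxP oU) => r c.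
have Cpart i : Ck_on k U (partial i f) by exact: smooth_derive.
under [X in Ck_on _ _ X]eq_fun do rewrite !mxE summxE.
apply: Ck_onD => //; first by have /(Ck_on_mxP oU) := Cv; apply.
under [X in Ck_on _ _ X]eq_fun do rewrite -mulN1r.
apply: Ck_onM => //; first exact: Ck_on_cst.
apply: Ck_on_sum => // i.
under [X in Ck_on _ _ X]eq_fun do rewrite summxE.
apply: Ck_on_sum => // j.
under [X in Ck_on _ _ X]eq_fun do rewrite mxE.
apply: Ck_onM => //; last by have /(Ck_on_mxP oU) := Cpart j; apply.
apply: Ck_onM => //; last exact: Ck_on_dotp.
apply: Ck_on_invmx => //.
  by move=> u Uu; exact: posdef_unitmx (Gpos Uu).
by move=> i' j'; have /(Ck_on_mxP oU) := sG k; apply.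
Qed.

(** The mean curvature is built by sums and products from the entries of the inverse metric and the
    first and second derivatives of [f]. *)
Lemma smooth_mean_curvature : smooth_on U (mean_curvature G f).
Proof.
move=> k; apply: Ck_onZ => //.
apply: Ck_on_sum => // i; apply: Ck_on_sum => // j.
apply/(Ck_on_mxP oU) => r c.
under [X in Ck_on _ _ X]eq_fun do rewrite mxE.
apply: Ck_onM => //.
  apply: Ck_on_invmx => //.
    by move=> u Uu; exact: posdef_unitmx (Gpos Uu).
  by move=> i' j'; have /(Ck_on_mxP oU) := sG k; apply.
have : Ck_on k U (fun u => normal_part G f u (partial i (partial j f) u)).
  by apply: Ck_on_normal_part; apply: smooth_derive; exact: smooth_derive.
by move=> /(Ck_on_mxP oU); apply.
Qed.

End SecondFundamentalForm.

(** * Parallel mean curvature and homothetic Laplace map in a chart *)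

Section PointwiseSplitting.
Context (R : realType) (V : lmodType R) (m : nat).
Context (e h : V -> 'rV[R]_m) (lam : R).
Hypothesis lam_gt0 : 0 < lam.
Hypothesis eD : forall a b, e (a + b) = e a + e b.
Hypothesis eZ : forall (k : R) a, e (k *: a) = k *: e a.
Hypothesis hD : forall a b, h (a + b) = h a + h b.
Hypothesis hZ : forall (k : R) a, h (k *: a) = k *: h a.
Hypothesis h_tangent : forall a, exists b, h a = e b.
Hypothesis h_sym : forall a b, dotp (h a) (e b) = dotp (e a) (h b).
Hypothesis h_homothetic : forall a b,
  dotp (h a) (h b) = lam ^+ 2 * dotp (e a) (e b).

(* With [h = e \o B], the operator [B] satisfies [B^2 = lam^2], and [a1], [a2]
   are the components of [a] along the eigenspaces of [B] for [-lam] and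
   [lam]. *)
Lemma eigenspace_splitting a : exists a1 a2,
  [/\ a = a1 + a2, e a1 + lam^-1 *: h a1 = 0 & e a2 - lam^-1 *: h a2 = 0].
Proof.
have [b hab] := h_tangent a; have [c hbc] := h_tangent b.
have lam0 : lam != 0 by rewrite gt_eqF.
(* This is [B^2 = lam^2]: the difference of the two sides is orthogonal to the image of [e] and lies
   in it. *)
have hbE : h b = lam ^+ 2 *: e a.
  apply/eqP; rewrite -subr_eq0 -dotp_eq0.
  have orth d : dotp (h b - lam ^+ 2 *: e a) (e d) = 0.
    by rewrite dotpBl dotpZl h_sym -hab h_homothetic subrr.
  have [d xd] : exists d, h b - lam ^+ 2 *: e a = e d.
    by exists (c + (- lam ^+ 2) *: a); rewrite eD eZ hbc scaleNr.
  by rewrite {2}xd orth.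
(* With [b = B a], these are the two spectral projections of [a]. *)
exists (2^-1 *: (a - lam^-1 *: b)), (2^-1 *: (a + lam^-1 *: b)).
have eN x y : e (x - y) = e x - e y by rewrite -scaleN1r eD eZ scaleN1r.
have hN x y : h (x - y) = h x - h y by rewrite -scaleN1r hD hZ scaleN1r.
have llh : lam^-1 *: (lam^-1 *: h b) = e a.
  by rewrite hbE !scalerA -invfM -expr2 mulVf ?expf_neq0// scale1r.
split.
- rewrite -scalerDr addrACA addNr addr0 scalerDr -scalerDl -[2^-1]mul1r.
  by rewrite -splitr scale1r.
- rewrite eZ hZ scalerA mulrC -scalerA -scalerDr eN hN eZ hZ -hab scalerBr llh.
  by rewrite addrA subrK subrr scaler0.
- rewrite eZ hZ scalerA mulrC -scalerA -scalerBr eD hD eZ hZ -hab.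
  rewrite [lam^-1 *: (_ + _)]scalerDr llh.
  by rewrite [X in _ - X]addrC subrr scaler0.
Qed.

End PointwiseSplitting.

Section PointwiseOrthogonality.
Context (R : realType) (V : lmodType R) (m : nat).
Context (y1 z1 : V -> 'rV[R]_m) (y2 z2 : V -> V -> 'rV[R]_m).
Context (y3 z3 : V -> V -> V -> 'rV[R]_m).

(* [dotp (y2 a b) (z1 c)] is symmetric in [a], [b] and in [b], [c], so that an
   argument in the kernel of [y1] or of [z1] can be moved to the slot where it
   makes the expression vanish. *)
Lemma orthogonal_second_first :
  (forall c, exists c1 c2, [/\ c = c1 + c2, y1 c1 = 0 & z1 c2 = 0]) ->
  (forall a b, z1 (a + b) = z1 a + z1 b) ->
  (forall a b, y2 a b = y2 b a) -> (forall a b, z2 a b = z2 b a) ->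
  (forall a b c, dotp (y2 a b) (z1 c) = - dotp (y1 b) (z2 a c)) ->
  forall a b c, dotp (y2 a b) (z1 c) = 0.
Proof.
move=> split1 z1D y2C z2C yz a b c.
have [c1 [c2 [-> yc1 zc2]]] := split1 c.
rewrite z1D zc2 addr0 yz z2C -yz y2C yz yc1 dotp0l oppr0//.
Qed.

(** The same transport one order higher, with [d] split into [d1 + d2]. Moving the derivative along
    [c] onto the other factor exposes [z1 d2 = 0]. For [d1], the symmetry of third derivatives
    carries it into the factor [y2], after which moving a derivative the other way exposes
    [y1 d1 = 0]. *)
Lemma orthogonal_second_second :
  (forall c, exists c1 c2, [/\ c = c1 + c2, y1 c1 = 0 & z1 c2 = 0]) ->
  (forall a b c, z2 a (b + c) = z2 a b + z2 a c) ->
  (forall a b, z2 a b = z2 b a) -> (forall a b c, y3 a b c = y3 c b a) ->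
  (forall a b c d, dotp (y3 c a b) (z1 d) = - dotp (y2 a b) (z2 c d)) ->
  (forall a b c d, dotp (z3 c a b) (y1 d) = - dotp (z2 a b) (y2 c d)) ->
  forall a b c d, dotp (y2 a b) (z2 c d) = 0.
Proof.
move=> split1 z2D z2C y3C yz zy a b c d.
have [d1 [d2 [-> yd1 zd2]]] := split1 d.
rewrite z2D dotpDr.
rewrite -[dotp _ (z2 c d2)]opprK -yz zd2 dotp0r oppr0 addr0.
rewrite z2C -[LHS]opprK -yz y3C yz dotpC opprK -[LHS]opprK -zy yd1 dotp0r.
by rewrite oppr0.
Qed.

End PointwiseOrthogonality.

(** * The sign argument at one point *)

Section TraceArgument.
Context (R : realType) (n m : nat) (n_gt0 : (0 < n)%N).
Context (G : 'rV[R]_n -> 'M[R]_n) (f : 'rV[R]_n -> 'rV[R]_m) (u : 'rV[R]_n).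
Hypothesis df : differentiable f u.
Hypothesis fG : forall a b, dotp ('D_a f u) ('D_b f u) = bilin (G u) a b.
Hypothesis Gpos : forall X : 'rV[R]_n, X != 0 -> 0 < bilin (G u) X X.
Context (y1 z1 : 'rV[R]_n -> 'rV[R]_m) (y2 z2 : 'I_n -> 'I_n -> 'rV[R]_m).
Context (H : 'rV[R]_m) (lam : R).
Hypothesis lam_gt0 : 0 < lam.
Hypothesis f_half : forall a, 'D_a f u = 2^-1 *: (y1 a + z1 a).
Hypothesis z1_tangent : forall a, exists b, z1 a = 'D_b f u.
Hypothesis y1z1 : forall a b, dotp (y1 a) (z1 b) = 0.
Hypothesis y2z1 : forall i j c, dotp (y2 i j) (z1 c) = 0.
Hypothesis z2y1 : forall i j c, dotp (z2 i j) (y1 c) = 0.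
Hypothesis y2z2 : forall i j k l, dotp (y2 i j) (z2 k l) = 0.
Hypothesis H_normal : forall b, dotp H ('D_b f u) = 0.
Hypothesis nH : n%:R *: H = metric_trace G u
  (fun i j => normal_part G f u (2^-1 *: (y2 i j + z2 i j))).
Hypothesis y2H : forall i j, dotp (y2 i j) H =
  - (lam / 2) * dotp (y1 (delta_mx 0 i)) (y1 (delta_mx 0 j)).

(** The tangential part of [y2 i j] is the derivative of [f] along [w]. Since [y2 i j] is orthogonal
    to the image of [z1], this part reduces to half of [y1 w], which is orthogonal to [z2 k l]; so
    the correction by tangential parts is zero. *)
Lemma dotp_normal_parts i j k l :
  dotp (normal_part G f u (y2 i j)) (normal_part G f u (z2 k l)) = 0.
Proof.
rewrite dotp_normal_part// normal_partE// dotpBl y2z2 sub0r.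
set w := tangent_coef G f u (y2 i j).
have z1w : z1 w = 0.
  have [b zb] := z1_tangent w.
  (* The same product equals half the squared length of [z1 w], because [f_half] splits the
     derivative of [f] and [y1] is orthogonal to [z1]. *)
  have : dotp ('D_w f u) (z1 w) = 0.
    by rewrite zb dotp_tangent_coef// -zb y2z1.
  rewrite f_half dotpZl dotpDl y1z1 add0r => /eqP.
  by rewrite mulf_eq0 invr_eq0 pnatr_eq0/= dotp_eq0 => /eqP.
by rewrite f_half z1w addr0 dotpZl dotpC z2y1 mulr0 oppr0.
Qed.

(** Orthogonality of [Y] and [Z] makes [n%:R * dotp Y H] half the squared length of [Y], whereas
    [y2H] makes [dotp Y H] a nonpositive multiple of a Gram trace; this trace is therefore at most
    zero. *)
Lemma first_factor_trivial i : y1 (delta_mx 0 i) = 0.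
Proof.
pose Y := metric_trace G u (fun i j => normal_part G f u (y2 i j)).
pose Z := metric_trace G u (fun i j => normal_part G f u (z2 i j)).
have YZ : dotp Y Z = 0.
  apply: dotp_metric_trace_eq0 => i' j'.
  rewrite dotpC; apply: dotp_metric_trace_eq0 => k l.
  by rewrite dotpC dotp_normal_parts.
have nHE : n%:R *: H = 2^-1 *: (Y + Z).
  rewrite nH -metric_traceD -metric_traceZ.
  by apply: eq_metric_trace => k l; rewrite normal_partZ// normal_partD.
have YH : dotp Y H = - (lam / 2) * \sum_i \sum_j invmx (G u) i j *
    dotp (y1 (delta_mx 0 i)) (y1 (delta_mx 0 j)).
  rewrite dotp_metric_trace mulr_sumr; apply: eq_bigr => k _.
  rewrite mulr_sumr; apply: eq_bigr => l _.
  by rewrite dotp_normal_part_id// y2H mulrCA.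
have YH_ge0 : 0 <= dotp Y H.
  have n0 : 0 < n%:R :> R by rewrite ltr0n.
  rewrite -(pmulr_rge0 _ n0) -dotpZr nHE dotpZr dotpDr YZ addr0.
  by rewrite mulr_ge0// ?invr_ge0// dotp_ge0.
apply: (gram_trace_le0 Gpos (metric_tr fG)
  (e := fun i => y1 (delta_mx 0 i))).
move: YH_ge0; rewrite YH mulNr oppr_ge0 pmulr_rle0//.
by rewrite divr_gt0.
Qed.

End TraceArgument.

(** The cross terms cancel by symmetry and the remaining two by homothety. *)
Lemma dotp_split (R : realType) (m : nat) (lam : R) (e1 e2 h1 h2 : 'rV[R]_m) :
  lam != 0 -> dotp h1 e2 = dotp e1 h2 ->
  dotp h1 h2 = lam ^+ 2 * dotp e1 e2 ->
  dotp (e1 + lam^-1 *: h1) (e2 + - lam^-1 *: h2) = 0.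
Proof.
move=> lam0 he hh; rewrite dotpDl !dotpDr !dotpZl !dotpZr he hh.
by field.
Qed.

(** * The local theorem: [f + H / lam] has zero differential *)

Section HomotheticMeanCurvature.
Context (R : realType) (n m : nat) (n_gt0 : (0 < n)%N).
Context (U : set 'rV[R]_n) (oU : open U).
Context (G : 'rV[R]_n -> 'M[R]_n) (f : 'rV[R]_n -> 'rV[R]_m) (lam : R).
Hypothesis sf : smooth_on U f.
Hypothesis sG : smooth_on U G.
Hypothesis fG : forall u, U u -> forall a b,
  dotp ('D_a f u) ('D_b f u) = bilin (G u) a b.
Hypothesis Gpos : forall u, U u -> forall X : 'rV[R]_n, X != 0 ->
  0 < bilin (G u) X X.
Local Notation H := (mean_curvature G f).
Hypothesis lam_gt0 : 0 < lam.
Hypothesis H_parallel : forall u, U u -> forall a,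
  normal_part G f u ('D_a H u) = 0.
Hypothesis H_homothetic : forall u, U u -> forall a b,
  dotp ('D_a H u) ('D_b H u) = lam ^+ 2 * bilin (G u) a b.

Let sH : smooth_on U H. Proof. exact: smooth_mean_curvature. Qed.

(** The map is hidden behind an existential because only its smoothness and its differential matter
    in what follows. *)
Lemma smooth_lincomb (k : R) (f1 f2 : 'rV[R]_n -> 'rV[R]_m) :
  smooth_on U f1 -> smooth_on U f2 -> exists2 y, smooth_on U y &
  forall u, U u -> forall a, 'D_a y u = 'D_a f1 u + k *: 'D_a f2 u.
Proof.
move=> s1 s2; exists (fun u => f1 u + k *: f2 u).
  by move=> j; apply: Ck_onD => //; exact: Ck_onZ.
move=> u Uu a; rewrite deriveD ?deriveZ//.
- exact: smooth_derivable Uu.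
- exact: smooth_derivable Uu.
- by apply: derivableZ; exact: smooth_derivable Uu.
Qed.

Lemma derive3C (y : 'rV[R]_n -> 'rV[R]_m) u a b c : smooth_on U y -> U u ->
  'D_a ('D_b ('D_c y)) u = 'D_c ('D_b ('D_a y)) u.
Proof.
move=> sy Uu.
apply: (etrans (schwarz oU a b (smooth_derive c sy) Uu)).
apply: (etrans _ (schwarz oU b c (smooth_derive a sy) Uu)).
apply: (open_near_eq_derive _ oU Uu) => x Ux.
exact: (schwarz oU a c sy Ux).
Qed.

Lemma derive_mean_curvature_tangent u a : U u -> exists b, 'D_a H u = 'D_b f u.
Proof.
move=> Uu; exists (tangent_coef G f u ('D_a H u)); apply: normal_part_eq0.
- exact: smooth_differentiable Uu.
- exact: H_parallel.
Qed.

(** Differentiating the normality of [H] turns both sides into minus the product of [H] with a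
    second derivative of [f], which is symmetric. *)
Lemma shape_operator_sym u a b : U u ->
  dotp ('D_a H u) ('D_b f u) = dotp ('D_a f u) ('D_b H u).
Proof.
move=> Uu.
have shape c d : dotp ('D_c H u) ('D_d f u) = - dotp (H u) ('D_c ('D_d f) u).
  apply: (@dotp_cst_derive _ _ _ _ oU H ('D_d f) u c 0) => //.
  - by move=> x Ux; exact: (mean_curvature_normal sf fG Gpos).
  - exact: smooth_derivable Uu.
  - by apply: smooth_derivable Uu; exact: smooth_derive.
apply: (etrans (shape a b)); apply: (etrans _ (dotpC _ _)).
apply: (etrans _ (esym (shape b a))).
exact: (congr1 (fun v => - dotp (H u) v) (schwarz oU a b sf Uu)).
Qed.

Lemma shape_operator_splitting u c : U u -> exists c1 c2,
  [/\ c = c1 + c2, 'D_c1 f u + lam^-1 *: 'D_c1 H u = 0 &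
      'D_c2 f u - lam^-1 *: 'D_c2 H u = 0].
Proof.
move=> Uu.
have df := smooth_differentiable sf Uu.
have dH := smooth_differentiable sH Uu.
apply: (@eigenspace_splitting _ _ _ (fun a => 'D_a f u) (fun a => 'D_a H u)).
- exact: lam_gt0.
- by move=> a b; exact: derive_addv.
- by move=> k a; exact: derive_scalev.
- by move=> a b; exact: derive_addv.
- by move=> k a; exact: derive_scalev.
- by move=> a; exact: derive_mean_curvature_tangent.
- by move=> a b; exact: shape_operator_sym.
- by move=> a b; rewrite H_homothetic// -fG.
Qed.

Lemma derive_focal_map_eq0 u a : U u ->
  'D_a f u + lam^-1 *: 'D_a H u = 0.
Proof.
have lam0 : lam != 0 by rewrite gt_eqF.
(* Up to constants, [y] and [z] are [f + H / lam] and [f - H / lam]. *)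
have [y sy dy] := smooth_lincomb lam^-1 sf sH.
have [z sz dz] := smooth_lincomb (- lam^-1) sf sH.
have split1 x c : U x ->
    exists c1 c2, [/\ c = c1 + c2, 'D_c1 y x = 0 & 'D_c2 z x = 0].
  move=> Ux; have [c1 [c2 [cE y0 z0]]] := shape_operator_splitting c Ux.
  exists c1, c2; split; [exact: cE|exact: (etrans (dy x Ux c1) y0)|].
  by apply: (etrans (dz x Ux c2)); rewrite scaleNr.
have yz x b c : U x -> dotp ('D_b y x) ('D_c z x) = 0.
  move=> Ux; rewrite (dy x Ux) (dz x Ux).
  exact: (dotp_split lam0 (shape_operator_sym b c Ux)
    (etrans (H_homothetic Ux b c) (congr1 _ (esym (fG Ux b c))))).
have y2z1E x b c d : U x ->
    dotp ('D_b ('D_c y) x) ('D_d z x) = - dotp ('D_c y x) ('D_b ('D_d z) x).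
  move=> Ux; apply: (@dotp_cst_derive _ _ _ _ oU ('D_c y) ('D_d z) x b 0) => //.
  - by move=> x' Ux'; exact: yz.
  - exact: smooth_derivable (smooth_derive c sy) Ux.
  - exact: smooth_derivable (smooth_derive d sz) Ux.
have y2z1 x b c d : U x -> dotp ('D_b ('D_c y) x) ('D_d z x) = 0.
  move=> Ux.
  apply: (@orthogonal_second_first _ _ _ (fun d => 'D_d y x)
    (fun d => 'D_d z x) (fun b c => 'D_b ('D_c y) x)
    (fun b c => 'D_b ('D_c z) x)).
  - by move=> e; exact: split1.
  - by move=> e1 e2; apply: derive_addv; exact: smooth_differentiable Ux.
  - by move=> e1 e2; exact: (schwarz oU _ _ sy Ux).
  - by move=> e1 e2; exact: (schwarz oU _ _ sz Ux).
  - by move=> e1 e2 e3; exact: y2z1E.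
have z2y1 x b c d : U x -> dotp ('D_b ('D_c z) x) ('D_d y x) = 0.
  move=> Ux; apply/eqP; rewrite dotpC -oppr_eq0 -(y2z1E _ _ _ _ Ux).
  exact/eqP/y2z1.
have y2z2 x b c d e : U x ->
    dotp ('D_b ('D_c y) x) ('D_d ('D_e z) x) = 0.
  move=> Ux.
  apply: (@orthogonal_second_second _ _ _ (fun d => 'D_d y x)
    (fun d => 'D_d z x) (fun b c => 'D_b ('D_c y) x)
    (fun b c => 'D_b ('D_c z) x) (fun b c d => 'D_b ('D_c ('D_d y)) x)
    (fun b c d => 'D_b ('D_c ('D_d z)) x)).
  - by move=> e1; exact: split1.
  - move=> e1 e2 e3.
    apply: (etrans (schwarz oU _ _ sz Ux)).
    apply: (etrans (derive_addv _ _
      (smooth_differentiable (smooth_derive e1 sz) Ux))).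
    exact: (congr2 +%R (schwarz oU _ _ sz Ux) (schwarz oU _ _ sz Ux)).
  - by move=> e1 e2; exact: (schwarz oU _ _ sz Ux).
  - by move=> e1 e2 e3; exact: derive3C.
  - move=> e1 e2 e3 e4.
    apply: (@dotp_cst_derive _ _ _ _ oU ('D_e1 ('D_e2 y)) ('D_e4 z) x
      e3 0) => //.
    + by move=> x' Ux'; exact: y2z1.
    + exact: smooth_derivable (smooth_derive _ (smooth_derive _ sy)) Ux.
    + exact: smooth_derivable (smooth_derive _ sz) Ux.
  - move=> e1 e2 e3 e4.
    apply: (@dotp_cst_derive _ _ _ _ oU ('D_e1 ('D_e2 z)) ('D_e4 y) x
      e3 0) => //.
    + by move=> x' Ux'; exact: z2y1.
    + exact: smooth_derivable (smooth_derive _ (smooth_derive _ sz)) Ux.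
    + exact: smooth_derivable (smooth_derive _ sy) Ux.
have half_sum (v w : 'rV[R]_m) (k : R) :
    v = 2^-1 *: ((v + k *: w) + (v + - k *: w)).
  rewrite scaleNr addrACA subrr addr0 -mulr2n -[v *+ 2]scaler_nat.
  by rewrite scalerA mulVf// scale1r.
have half_diff (v w : 'rV[R]_m) :
    w = (lam / 2) *: ((v + lam^-1 *: w) - (v + - lam^-1 *: w)).
  rewrite scaleNr opprB addrC addrA subrK -scalerDl scalerA.
  by rewrite (_ : _ * _ = 1) ?scale1r//; field.
have dotp_half_diff (p q r v : 'rV[R]_m) : v = (lam / 2) *: (p - r) ->
    dotp q r = 0 -> - dotp q v = - (lam / 2) * dotp p q.
  by move=> -> qr; rewrite dotpZr dotpBr qr subr0 dotpC mulNr.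
have f_half x d : U x -> 'D_d f x = 2^-1 *: ('D_d y x + 'D_d z x).
  by move=> Ux; rewrite dy// dz//; exact: half_sum.
have f2_half x b c : U x ->
    'D_b ('D_c f) x = 2^-1 *: ('D_b ('D_c y) x + 'D_b ('D_c z) x).
  move=> Ux.
  have dcy : derivable ('D_c y) x b := smooth_derivable (smooth_derive c sy) Ux.
  have dcz : derivable ('D_c z) x b := smooth_derivable (smooth_derive c sz) Ux.
  apply: (etrans (@open_near_eq_derive _ _ _ _ _ (2^-1 *: ('D_c y + 'D_c z))
    _ b oU Ux (fun x' Ux' => f_half x' c Ux'))).
  apply: (etrans (deriveZ _ (derivableD dcy dcz))).
  exact: (congr1 ( *:%R 2^-1) (deriveD dcy dcz)).
move=> Uu.
have df := smooth_differentiable sf Uu.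
have H_normal x b : U x -> dotp (H x) ('D_b f x) = 0.
  by move=> Ux; exact: (mean_curvature_normal sf fG Gpos).
have tangent (k : R) d : exists b, 'D_d f u + k *: 'D_d H u = 'D_b f u.
  have [b ->] := derive_mean_curvature_tangent d Uu.
  by exists (d + k *: b); rewrite derive_addv// derive_scalev.
(* Parallelism makes the differential of [H], and hence that of [y], tangent. *)
have y1H x d : U x -> dotp ('D_d y x) (H x) = 0.
  move=> Ux; have [b bE] := derive_mean_curvature_tangent d Ux.
  rewrite (dy x Ux) bE dotpC dotpDr dotpZr (H_normal x d Ux) (H_normal x b Ux).
  by rewrite mulr0 addr0.
rewrite -dy// (derive_partial a (smooth_differentiable sy Uu)) big1// => i _.
apply/eqP; rewrite scaler_eq0; apply/orP; right; apply/eqP.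
apply: (@first_factor_trivial _ _ _ n_gt0 G f u df (fG Uu) (Gpos Uu)
  (fun d => 'D_d y u) (fun d => 'D_d z u)
  (fun i j => 'D_(delta_mx 0 i) ('D_(delta_mx 0 j) y) u)
  (fun i j => 'D_(delta_mx 0 i) ('D_(delta_mx 0 j) z) u) (H u) lam lam_gt0).
- by move=> d; exact: f_half.
- by move=> d; rewrite dz.
- by move=> b c; exact: yz.
- by move=> j k c; exact: y2z1.
- by move=> j k c; exact: z2y1.
- by move=> j k j' k'; exact: y2z2.
- by move=> b; exact: H_normal.
- rewrite scale_mean_curvature//; apply: eq_metric_trace => j k.
  exact: (congr1 (normal_part G f u) (f2_half _ _ _ Uu)).
(* Differentiating [y1H] moves one derivative onto [H], whose differential is [lam / 2] times that
   of [y - z]; the [z] term drops out by orthogonality. *)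
- move=> j k; set dj := delta_mx 0 j; set dk := delta_mx 0 k.
  have H1 : 'D_dj H u = (lam / 2) *: ('D_dj y u - 'D_dj z u).
    by rewrite (dy u Uu) (dz u Uu); exact: half_diff.
  apply: (etrans (@dotp_cst_derive _ _ _ _ oU ('D_dk y) H u dj 0 Uu
    (fun x Ux => y1H x dk Ux) _ _)).
  + exact: smooth_derivable (smooth_derive _ sy) Uu.
  + exact: smooth_derivable sH Uu.
  + exact: (dotp_half_diff _ _ _ _ H1 (yz u dk dj Uu)).
Qed.

End HomotheticMeanCurvature.

(** * Independence of the chart *)

Lemma is_derive_scale (R : realType) (V : normedModType R) (p q : nat)
    (h : V -> R) (F : V -> 'M[R]_(p, q)) u b :
  derivable h u b -> derivable F u b ->
  is_derive u b (fun x => h x *: F x) ('D_b h u *: F u + h u *: 'D_b F u).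
Proof.
move=> dh dF.
have dFij i j : derivable (fun x => F x i j) u b.
  by have /derivable_mxP := dF; apply.
have dhF : derivable (fun x => h x *: F x) u b.
  apply/derivable_mxP => i j; under eq_fun do rewrite mxE.
  exact: (derivableM dh (dFij i j)).
apply: DeriveDef => //; apply/matrixP => i j.
rewrite -(derive_mx_coord i j dhF); under eq_fun do rewrite mxE.
rewrite (deriveM dh (dFij i j)) (derive_mx_coord i j dF) !mxE addrC.
by congr (_ + _); exact: mulrC.
Qed.

(** Tensoriality of the trace: the Jacobians are moved from the bilinear form [C] to the inverse
    metric [P]. *)
Lemma metric_trace_congruence (R : realType) (n m : nat) (J P : 'M[R]_n)
    (C : 'I_n -> 'I_n -> 'rV[R]_m) :
  \sum_i \sum_j P i j *: \sum_k J j k *: \sum_l J i l *: C l k =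
  \sum_l \sum_k (J^T *m P *m J) l k *: C l k.
Proof.
transitivity (\sum_i \sum_j \sum_k \sum_l (P i j * J j k * J i l) *: C l k).
  apply: eq_bigr => i _; apply: eq_bigr => j _; rewrite scaler_sumr.
  apply: eq_bigr => k _; rewrite scalerA scaler_sumr.
  by apply: eq_bigr => l _; rewrite scalerA.
transitivity (\sum_l \sum_k \sum_j \sum_i (P i j * J j k * J i l) *: C l k).
  under eq_bigr do under eq_bigr do rewrite exchange_big/=.
  under eq_bigr do rewrite exchange_big/=.
  rewrite exchange_big/=; apply: eq_bigr => l _.
  rewrite exchange_big/= exchange_big/=.
  under eq_bigr do rewrite exchange_big/=.
  by rewrite exchange_big; under eq_bigr do rewrite exchange_big/=.
apply: eq_bigr => l _; apply: eq_bigr => k _.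
rewrite [X in X *: _]mxE scaler_suml; apply: eq_bigr => j _.
rewrite [X in X * _]mxE mulr_suml scaler_suml; apply: eq_bigr => i _.
by rewrite [in RHS]mxE; congr (_ *: _); ring.
Qed.

Section ChangeOfChart.
Context (R : realType) (n m : nat).
Context (U1 U2 : set 'rV[R]_n) (oU1 : open U1).
Context (phi : 'rV[R]_n -> 'rV[R]_n) (G1 G2 : 'rV[R]_n -> 'M[R]_n).
Context (f1 f2 : 'rV[R]_n -> 'rV[R]_m) (u : 'rV[R]_n) (Uu : U1 u).
Hypothesis phiU : forall x, U1 x -> U2 (phi x).
Hypothesis sphi : smooth_on U1 phi.
Hypothesis sf2 : smooth_on U2 f2.
Hypothesis f12 : forall x, U1 x -> f1 x = f2 (phi x).
Hypothesis fG1 : forall a b, dotp ('D_a f1 u) ('D_b f1 u) = bilin (G1 u) a b.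
Hypothesis fG2 : forall a b,
  dotp ('D_a f2 (phi u)) ('D_b f2 (phi u)) = bilin (G2 (phi u)) a b.
Hypothesis G1pos : forall X : 'rV[R]_n, X != 0 -> 0 < bilin (G1 u) X X.
Hypothesis G2pos : forall X : 'rV[R]_n, X != 0 -> 0 < bilin (G2 (phi u)) X X.

Lemma is_derive_chain (h : 'rV[R]_n -> 'rV[R]_m) x a : U1 x -> smooth_on U2 h ->
  is_derive x a (fun y => h (phi y)) ('D_('D_a phi x) h (phi x)).
Proof.
move=> Ux sh.
have dphi := smooth_differentiable sphi Ux.
have dh := smooth_differentiable sh (phiU Ux).
have dhphi : differentiable (h \o phi) x by exact: differentiable_comp.
apply: DeriveDef; first exact: diff_derivable.
rewrite -[X in derive X]/(h \o phi) (deriveE a dhphi) diff_comp//.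
rewrite (deriveE _ dh).
by rewrite (deriveE a dphi).
Qed.

Let df1 : differentiable f1 u.
Proof.
have nU : nbhs u U1 by exact: open_nbhs_nbhs.
apply: (@near_eq_differentiable _ _ _ (f2 \o phi)).
  by apply: filterS nU => x Ux; rewrite f12.
apply: differentiable_comp; first exact: smooth_differentiable Uu.
exact: smooth_differentiable (phiU Uu).
Qed.

Let df2 : differentiable f2 (phi u).
Proof. exact: smooth_differentiable (phiU Uu). Qed.

Lemma derive_chart x a : U1 x -> 'D_a f1 x = 'D_('D_a phi x) f2 (phi x).
Proof.
move=> Ux; apply: (etrans (open_near_eq_derive a oU1 Ux f12)).
by have [_ ->] := is_derive_chain a Ux sf2.
Qed.

(** Jacobian matrix in the row convention, acting on row vectors from the right. *)
Let J : 'M[R]_n := \matrix_(i, j) ('D_(delta_mx 0 i) phi u) 0 j.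

Lemma derive_jacobian a : 'D_a phi u = a *m J.
Proof.
rewrite (derive_partial a (smooth_differentiable sphi Uu)); apply/rowP => j.
by rewrite summxE [RHS]mxE; apply: eq_bigr => i _; rewrite !mxE.
Qed.

Lemma metric_jacobian : G1 u = J *m G2 (phi u) *m J^T.
Proof.
apply/matrixP => i j; rewrite -bilin_delta -fG1.
rewrite (derive_chart _ Uu) [X in dotp _ X](derive_chart _ Uu) fG2.
by rewrite !derive_jacobian -[RHS]bilin_delta /bilin trmx_mul !mulmxA.
Qed.

(** Invertibility is read off from [G1 u = J *m G2 (phi u) *m J^T], whose left side is
    invertible. *)
Lemma jacobian_unit : J \in unitmx.
Proof.
have := posdef_unitmx G1pos; rewrite metric_jacobian.
by rewrite !unitmx_mul => /andP[/andP[]].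
Qed.

Lemma invmx_metric_jacobian : J^T *m invmx (G1 u) *m J = invmx (G2 (phi u)).
Proof.
have JT : J^T \in unitmx by rewrite unitmx_tr jacobian_unit.
have G1u := posdef_unitmx G1pos; have G2u := posdef_unitmx G2pos.
rewrite -[LHS](mulmxK G2u) -[RHS]mul1mx; congr (_ *m _).
rewrite -[LHS](mulmxK JT) -!mulmxA [J *m _]mulmxA [J *m _ *m _]mulmxA.
by rewrite -metric_jacobian (mulmxA (invmx _)) mulVmx// mul1mx mulmxV.
Qed.

(** As [J] is invertible, both charts have the same tangent space, hence the same orthogonal
    decomposition of [v]. *)
Lemma normal_part_chart v :
  normal_part G1 f1 u v = normal_part G2 f2 (phi u) v.
Proof.
set c := tangent_coef G2 f2 (phi u) v.
have cE : 'D_c f2 (phi u) = 'D_(c *m invmx J) f1 u.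
  by rewrite (derive_chart _ Uu) derive_jacobian mulmxKV// jacobian_unit.
have vE : v = normal_part G2 f2 (phi u) v + 'D_(c *m invmx J) f1 u.
  by rewrite (normal_partE G2 df2) -cE subrK.
apply: (etrans (congr1 (normal_part G1 f1 u) vE)).
apply: (etrans (normal_partD G1 df1 _ _)).
rewrite (normal_part_tangent df1 fG1 G1pos) addr0.
apply: (normal_part_id G1 df1) => b.
by rewrite (derive_chart b Uu) (normal_part_orth df2 fG2 G2pos).
Qed.

Lemma second_fundamental_form_chart i j :
  second_fundamental_form G1 f1 u i j = \sum_k J j k *: \sum_l J i l *:
    second_fundamental_form G2 f2 (phi u) l k.
Proof.
rewrite /second_fundamental_form.
have dphi2 : differentiable ('D_(delta_mx 0 j) phi) u.
  exact: smooth_differentiable (smooth_derive _ sphi) Uu.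
pose ei : 'rV[R]_n := delta_mx 0 i; pose ej : 'rV[R]_n := delta_mx 0 j.
have dk k : is_derive u ei (fun x => ('D_ej phi x) 0 k *: partial k f2 (phi x))
    (('D_ei ('D_ej phi) u) 0 k *: partial k f2 (phi u) +
     J j k *: 'D_('D_ei phi u) (partial k f2) (phi u)).
  have [dF dFE] := is_derive_chain ei Uu (smooth_derive (delta_mx 0 k) sf2).
  have dJ : derivable ('D_ej phi) u ei by exact: diff_derivable.
  rewrite -dFE -(derive_mx_coord 0 k dJ).
  have -> : J j k = ('D_ej phi u) 0 k by rewrite mxE.
  apply: is_derive_scale dF.
  by have /derivable_mxP := dJ; apply.
have -> : partial i (partial j f1) u =
    \sum_k (('D_ei ('D_ej phi) u) 0 k *: partial k f2 (phi u) +
     J j k *: 'D_('D_ei phi u) (partial k f2) (phi u)).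
  apply: (etrans (@open_near_eq_derive _ _ _ _ _
    (\sum_k (fun x => ('D_ej phi x) 0 k *: partial k f2 (phi x)))
    u ei oU1 Uu _)).
    move=> x Ux; rewrite fct_sumE /partial (derive_chart _ Ux).
    exact: derive_partial (smooth_differentiable sf2 (phiU Ux)).
  by have [_ ->] := is_derive_sum dk.
rewrite big_split/= normal_partD//.
(* The second derivatives of [phi] contribute only a tangent vector, which the normal projection
   kills; this is why the second fundamental form is a tensor. *)
have -> : \sum_k ('D_ei ('D_ej phi) u) 0 k *: partial k f2 (phi u) =
    'D_(('D_ei ('D_ej phi) u) *m invmx J) f1 u.
  rewrite (derive_chart _ Uu) derive_jacobian mulmxKV ?jacobian_unit//.
  by rewrite [RHS]derive_partial.
rewrite normal_part_tangent// add0r normal_part_chart.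
rewrite normal_part_sum//; apply: eq_bigr => k _.
rewrite normal_partZ//; congr (_ *: _).
rewrite derive_partial; last first.
  exact: smooth_differentiable (smooth_derive _ sf2) (phiU Uu).
rewrite normal_part_sum//; apply: eq_bigr => l _.
by rewrite normal_partZ// mxE.
Qed.

Lemma mean_curvature_chart :
  mean_curvature G1 f1 u = mean_curvature G2 f2 (phi u).
Proof.
pose C l k := second_fundamental_form G2 f2 (phi u) l k.
apply: (congr1 ( *:%R n%:R^-1)).
apply: (etrans (eq_metric_trace _ _ second_fundamental_form_chart)).
apply: (etrans (metric_trace_congruence J (invmx (G1 u)) C)).
exact: (congr1 (fun P : 'M[R]_n => \sum_l \sum_k P l k *: C l k)
  invmx_metric_jacobian).
Qed.

End ChangeOfChart.

(** * Submanifolds of a sphere *)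

Section SphereMeanCurvature.
Context (R : realType) (n m : nat) (n_gt0 : (0 < n)%N).
Context (U : set 'rV[R]_n) (oU : open U).
Context (G : 'rV[R]_n -> 'M[R]_n) (f : 'rV[R]_n -> 'rV[R]_m) (a : 'rV[R]_m).
Hypothesis sf : smooth_on U f.
Hypothesis fG : forall u, U u -> forall b c,
  dotp ('D_b f u) ('D_c f u) = bilin (G u) b c.
Hypothesis Gpos : forall u, U u -> forall X : 'rV[R]_n, X != 0 ->
  0 < bilin (G u) X X.
Hypothesis radial_normal : forall u, U u -> forall b,
  dotp (f u - a) ('D_b f u) = 0.

(** Obtained by differentiating [radial_normal]: the second fundamental form in the radial direction
    is minus the metric. *)
Lemma dotp_second_derivative_radial u i j : U u ->
  dotp (partial i (partial j f) u) (f u - a) = - G u i j.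
Proof.
move=> Uu; have df : derivable f u (delta_mx 0 i) := smooth_derivable sf Uu.
have da : derivable (fun x => f x - a) u (delta_mx 0 i).
  exact: (derivableB df (derivable_cst a u (delta_mx 0 i))).
have ddf : derivable (partial j f) u (delta_mx 0 i).
  exact: smooth_derivable (smooth_derive _ sf) Uu.
have daE : 'D_(delta_mx 0 i) (fun x => f x - a) u = partial i f u.
  apply: (etrans (deriveB df (derivable_cst a u (delta_mx 0 i)))).
  by rewrite derive_cst subr0.
have := @dotp_cst_derive _ _ _ _ oU (fun x => f x - a) (partial j f) u
  (delta_mx 0 i) 0 Uu (fun x Ux => radial_normal Ux _) da ddf.
rewrite daE -(metric_matrixE (fG Uu)) => ->.
by rewrite opprK; exact: dotpC.
Qed.

Lemma dotp_mean_curvature_radial u : U u ->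
  dotp (mean_curvature G f u) (f u - a) = -1.
Proof.
move=> Uu; have n0 : n%:R != 0 :> R by rewrite pnatr_eq0 -lt0n.
apply: (mulfI n0).
rewrite (dotp_mean_curvature n_gt0 G sf Uu (radial_normal Uu)).
rewrite mulrN1 -(trace_invmx_self (Gpos Uu) (metric_tr (fG Uu))) -sumrN.
apply: eq_bigr => i _; rewrite -sumrN; apply: eq_bigr => j _.
by rewrite (dotp_second_derivative_radial i j Uu) mulrN.
Qed.

(** Projecting to the sphere removes from each second derivative its radial component, a normal
    vector proportional to the metric coefficient; the trace of the metric against itself is [n]. *)
Lemma sphere_mean_curvatureE u : U u ->
  sphere_mean_curvature a G f u =
  mean_curvature G f u + (dotp (f u - a) (f u - a))^-1 *: (f u - a).
Proof.
move=> Uu; have df := smooth_differentiable sf Uu.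
have n0 : n%:R != 0 :> R by rewrite pnatr_eq0 -lt0n.
set w := f u - a; set q := dotp w w.
have sffE i j : sphere_second_fundamental_form a G f u i j =
    second_fundamental_form G f u i j + q^-1 *: (G u i j *: w).
  rewrite /sphere_second_fundamental_form /sphere_tangent_part.
  rewrite (normal_partB _ df) (normal_partZ _ df).
  rewrite (normal_part_id _ df (radial_normal Uu)).
  rewrite (dotp_second_derivative_radial i j Uu) -/w -/q.
  by rewrite mulNr scaleNr opprK scalerA mulrC.
apply: (@scalerI _ _ n%:R) => //; rewrite scalerA mulfV// scale1r scalerDr.
rewrite (scale_mean_curvature n_gt0) (eq_metric_trace _ _ sffE) metric_traceD.
congr (_ + _); rewrite metric_traceZ scalerA mulrC -scalerA; congr (_ *: _).
rewrite -(trace_invmx_self (Gpos Uu) (metric_tr (fG Uu))) scaler_suml.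
apply: eq_bigr => i _; rewrite scaler_suml; apply: eq_bigr => j _.
by rewrite scalerA.
Qed.

End SphereMeanCurvature.

Lemma derive0_ball_cst (R : realType) (V : normedModType R) (m : nat)
    (f : V -> 'rV[R]_m) u v (r : R) :
  (forall x, ball u r x -> differentiable f x) ->
  (forall x, ball u r x -> forall a, 'D_a f x = 0) ->
  ball u r v -> f v = f u.
Proof.
move=> df f0 uv; apply/rowP => k.
have seg t : 0 <= t <= 1 -> ball u r (u + t *: (v - u)).
  move=> /andP[t0 t1]; move: uv; rewrite -!ball_normE /ball_/=.
  rewrite opprD addrA subrr add0r normrN normrZ (ger0_norm t0) distrC.
  by apply: le_lt_trans; rewrite ler_piMl.
have [|t t01] := @mean_value_segment _ _ (fun x => f x 0 k) u (v - u).
  by move=> t t01; apply: differentiable_mx_coord; exact/df/seg.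
rewrite (addrC u (v - u)) subrK derive_mx_coord; last first.
  exact/diff_derivable/df/seg.
by rewrite f0 ?mxE; [move/eqP; rewrite subr_eq0 => /eqP|exact: seg].
Qed.

(** * Topology of charts and locally constant maps *)

Section Charts.
Context (R : realType) (n : nat) (M : topologicalType).
Context (A : smooth_manifold R n M).
Implicit Types (i j : Defs.index A) (p : M) (u : 'rV[R]_n).

Lemma chart_imageP i u : (chart i @` dom i) u ->
  dom i (param i u) /\ chart i (param i u) = u.
Proof. by move=> [p ip <-]; rewrite chartK. Qed.

Lemma nbhs_chart i p (B : set 'rV[R]_n) : dom i p ->
  nbhs (chart i p) B -> nbhs p (chart i @^-1` B).
Proof.
move=> ip; have := @chart_continuous _ _ _ A i.
rewrite continuous_open_subspace; last exact: dom_open.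
by move=> /(_ p); rewrite inE => /(_ ip); apply.
Qed.

Lemma open_overlap i j : open (chart i @` (dom i `&` dom j)).
Proof.
rewrite openE => _ [p [ip jp] <-]; rewrite /interior.
have pc : {for chart i p, continuous (param i)}.
  have := @param_continuous _ _ _ A i.
  rewrite continuous_open_subspace; last exact: chart_open.
  by move=> /(_ (chart i p)); rewrite inE; apply; exists p.
have nj : nbhs (chart i p) (param i @^-1` dom j).
  apply: pc; rewrite chartK//; apply: open_nbhs_nbhs; split => //.
  exact: dom_open.
have ni : nbhs (chart i p) (chart i @` dom i).
  by apply: open_nbhs_nbhs; split; [exact: chart_open|exists p].
apply: filterS2 ni nj => u /chart_imageP[iu uE] ju.
by exists (param i u).
Qed.

(** By the mean value theorem on a ball inside a chart, [F] is locally constant, so its level set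
    through [q] is open and closed. *)
Lemma connected_derive0_cst (m : nat) (F : M -> 'rV[R]_m) :
  connected [set: M] ->
  (forall i u, (chart i @` dom i) u -> differentiable (F \o param i) u) ->
  (forall i u, (chart i @` dom i) u ->
     forall a, 'D_a (F \o param i) u = 0) ->
  forall p q, F p = F q.
Proof.
move=> cM dF F0 p q.
have locally_cst p0 : \forall p1 \near p0, F p1 = F p0.
  have [i ip] := dom_cover A p0.
  have Uip : (chart i @` dom i) (chart i p0) by exists p0.
  have : nbhs (chart i p0) (chart i @` dom i).
    by apply: open_nbhs_nbhs; split => //; exact: chart_open.
  move=> /nbhs_ballP[r /= r0 rU].
  have nb := nbhs_chart ip (nbhsx_ballx (chart i p0) _ r0).
  have ni : nbhs p0 (dom i).
    by apply: open_nbhs_nbhs; split => //; exact: dom_open.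
  apply: filterS2 ni nb => p1 ip1 p1r.
  have := @derive0_ball_cst _ _ _ (F \o param i) (chart i p0) (chart i p1) r.
  rewrite /= !chartK//; apply => // x xr; [exact/dF/rU|exact/F0/rU].
pose B := [set p1 | F p1 = F q].
have oB : open B.
  rewrite openE => p1 p1q; near=> p2; rewrite /B/= -p1q.
  by near: p2; exact: locally_cst.
have cB : closed B.
  rewrite -openC openE => p1 p1q; rewrite /interior; near=> p2.
  by rewrite /B/= (near (locally_cst p1) p2).
suff BT : B = [set: M] by have : B p by rewrite BT.
apply: cM; first by exists q.
- by exists B => //; rewrite setTI.
- by exists B => //; rewrite setTI.
Unshelve. all: by end_near. Qed.

End Charts.

(** * The global statement *)

Section IsometricImmersion.
Context (R : realType) (n m : nat) (n_gt0 : (0 < n)%N).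
Context (M : topologicalType) (A : smooth_manifold R n M).
Context (g : riemannian_metric A) (x : M -> 'rV[R]_m).
Hypothesis x_iso : isometric_immersion g x.
Implicit Types (i : Defs.index A) (p : M) (u a b : 'rV[R]_n).

Let H := mean_curvature_vector g x.

Lemma chart_at_dom p : dom (chart_at A p) p.
Proof. exact: svalP (cid (dom_cover A p)). Qed.

Lemma immersion_smooth i : smooth_on (chart i @` dom i) (x \o param i).
Proof. by have [[sx _] _] := x_iso; exact: sx. Qed.

Lemma immersion_metric i u : (chart i @` dom i) u -> forall a b,
  dotp ('D_a (x \o param i) u) ('D_b (x \o param i) u) =
  bilin (metric g i u) a b.
Proof.
move=> Uu a b; have df := smooth_differentiable (@immersion_smooth i) Uu.
have [_ /(_ i (param i u))] := x_iso.
have [iu uE] := chart_imageP Uu; move=> /(_ iu a b).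
by rewrite /tangent_map uE -!deriveE.
Qed.

Lemma metric_posdef i u : (chart i @` dom i) u ->
  forall X : 'rV[R]_n, X != 0 -> 0 < bilin (metric g i u) X X.
Proof. by move=> [p ip <-]; exact: metric_pos. Qed.

(** Frees [H] from the chart chosen at [p], by the change of chart along the transition map from
    that chart to [i]. Only then can [H] be differentiated in a fixed chart. *)
Lemma mean_curvature_vectorE i p : dom i p ->
  H p = mean_curvature (metric g i) (x \o param i) (chart i p).
Proof.
move=> ip; have ip0 := chart_at_dom p; rewrite /H /mean_curvature_vector.
set i0 := chart_at A p in ip0 *.
have Up0 : (chart i0 @` dom i0) (chart i0 p) by exists p.
have Up : (chart i @` dom i) (chart i p) by exists p.
have phip : (chart i \o param i0) (chart i0 p) = chart i p by rewrite /= chartK.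
transitivity (mean_curvature (metric g i) (x \o param i)
    ((chart i \o param i0) (chart i0 p))); last by rewrite phip.
apply: (@mean_curvature_chart _ _ _ (chart i0 @` (dom i0 `&` dom i))
  (chart i @` dom i)).
- exact: open_overlap.
- by exists p.
- by move=> _ [q [q0 qi] <-]; rewrite /= chartK//; exists q.
- exact: transition_smooth.
- exact: immersion_smooth.
- by move=> _ [q [q0 qi] <-]; rewrite /= !chartK.
- exact: immersion_metric.
- by rewrite phip; exact: immersion_metric.
- exact: metric_posdef.
- by rewrite phip; exact: metric_posdef.
Qed.

Lemma mean_curvature_vector_param i u : (chart i @` dom i) u ->
  mean_curvature (metric g i) (x \o param i) u = (H \o param i) u.
Proof.
move=> Uu; have [iu uE] := chart_imageP Uu.
by rewrite /= (mean_curvature_vectorE iu) uE.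
Qed.

Lemma mean_curvature_vector_smooth i :
  smooth_on (chart i @` dom i) (H \o param i).
Proof.
move=> k; apply: (eq_Ck_on (@chart_open _ _ _ A i)
  (@mean_curvature_vector_param i)).
apply: (smooth_mean_curvature (@chart_open _ _ _ A i) (@immersion_smooth i)
  (@metric_smooth _ _ _ _ g i)).
exact: metric_posdef.
Qed.

Lemma laplace_mapE p : laplace_map g x p = - (n%:R *: H p).
Proof.
apply: (laplacianE n_gt0 (@chart_open _ _ _ A _) (@immersion_smooth _)
  (@metric_smooth _ _ _ _ g _)).
- exact: immersion_metric.
- by exists p => //; exact: chart_at_dom.
Qed.

Lemma tangent_mapE (F : M -> 'rV[R]_m) i p a : dom i p ->
  smooth_on (chart i @` dom i) (F \o param i) ->
  tangent_map F i p a = 'D_a (F \o param i) (chart i p).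
Proof.
move=> ip sF; rewrite deriveE//; apply: (smooth_differentiable sF).
by exists p.
Qed.

Lemma homothetic_position_mean_curvature : connected [set: M] ->
  parallel_mean_curvature_vector g x -> homothetic g (laplace_map g x) ->
  exists2 lam, 0 < lam & forall p q, x p + lam^-1 *: H p = x q + lam^-1 *: H q.
Proof.
move=> cM Hpar [c c0 hom].
have n0 : 0 < n%:R :> R by rewrite ltr0n.
(* The Laplace map is [- n H], so its ratio [c] corresponds to the ratio [c / n] for [H]. *)
exists (c / n%:R); first by rewrite divr_gt0.
set lam := c / n%:R.
have lam0 : 0 < lam by rewrite divr_gt0.
have sx := immersion_smooth; have sH := mean_curvature_vector_smooth.
have dsum i u a : (chart i @` dom i) u ->
    is_derive u a ((fun p => x p + lam^-1 *: H p) \o param i)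
      ('D_a (x \o param i) u + lam^-1 *: 'D_a (H \o param i) u).
  move=> Uu; apply: is_deriveD; first exact/derivableP/smooth_derivable/Uu/sx.
  by apply: is_deriveZ; exact/derivableP/smooth_derivable/Uu/sH.
apply: (connected_derive0_cst (A := A) cM) => i u Uu.
  apply: (@differentiableD _ _ _ (x \o param i) (lam^-1 *: (H \o param i))).
    exact: smooth_differentiable Uu.
  by apply: differentiableZ; exact: smooth_differentiable Uu.
move=> a; have [_ ->] := dsum i u a Uu.
have DH v b : (chart i @` dom i) v ->
    'D_b (mean_curvature (metric g i) (x \o param i)) v =
    'D_b (H \o param i) v.
  move=> Uv; apply: (open_near_eq_derive b (@chart_open _ _ _ A i) Uv).
  exact: mean_curvature_vector_param.
rewrite -DH//.
apply: (derive_focal_map_eq0 n_gt0 (@chart_open _ _ _ A i) (sx i)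
  (@metric_smooth _ _ _ _ g i) _ _ lam0 _ _ _ Uu).
- exact: immersion_metric.
- exact: metric_posdef.
- move=> v Uv b; rewrite DH//; have [iv vE] := chart_imageP Uv.
  have := Hpar i _ iv b.
  rewrite -/H (tangent_mapE b iv (sH i)) vE; exact.
- move=> v Uv b d.
  apply: (etrans (congr2 (@dotp R m) (DH v b Uv) (DH v d Uv))).
  have [iv vE] := chart_imageP Uv.
  have DL e : tangent_map (laplace_map g x) i (param i v) e =
      - (n%:R *: 'D_e (H \o param i) v).
    rewrite /tangent_map vE.
    have -> : laplace_map g x \o param i = - (n%:R *: (H \o param i)).
      by apply/funext => w; rewrite /= laplace_mapE.
    have dH := smooth_differentiable (sH i) Uv.
    rewrite -deriveE; last exact/differentiableN/differentiableZ.
    have dHe : derivable (H \o param i) v e by exact: diff_derivable.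
    apply: (etrans (deriveN (@derivableZ _ _ _ (H \o param i) n%:R v e dHe))).
    exact: (congr1 -%R (@deriveZ _ _ _ (H \o param i) n%:R v e dHe)).
  have := hom i _ iv b d.
  rewrite !DL vE !(dotpNl, dotpNr, dotpZl, dotpZr) opprK.
  rewrite mulrA -expr2 => E; apply: (mulfI (lt0r_neq0 (exprn_gt0 2 n0))).
  rewrite E /lam expr_div_n mulrA (mulrC (n%:R ^+ 2)) divfK//.
  by rewrite expf_neq0// gt_eqF.
Qed.

Lemma sphere_mean_curvature_vectorE (y : 'rV[R]_m) p :
  let i := chart_at A p in
  (forall u, (chart i @` dom i) u -> forall b,
     dotp ((x \o param i) u - y) ('D_b (x \o param i) u) = 0) ->
  dotp (H p) (x p - y) = -1 /\
  sphere_mean_curvature y (metric g i) (x \o param i) (chart i p) =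
    H p + (dotp (x p - y) (x p - y))^-1 *: (x p - y).
Proof.
move=> i radial; have ip := chart_at_dom p.
have Up : (chart i @` dom i) (chart i p) by exists p.
have xE : (x \o param i) (chart i p) = x p by rewrite /= chartK.
have radialE := sphere_mean_curvatureE n_gt0 (@chart_open _ _ _ A i)
  (@immersion_smooth i) (@immersion_metric i) (@metric_posdef i) radial Up.
have m1 := dotp_mean_curvature_radial n_gt0 (@chart_open _ _ _ A i)
  (@immersion_smooth i) (@immersion_metric i) (@metric_posdef i) radial Up.
by rewrite radialE -m1 xE.
Qed.

End IsometricImmersion.

Theorem theorem2p3 (R : realType) (n m : nat) (n_gt0 : (0 < n)%N)
    (M : topologicalType) (A : smooth_manifold R n M)
    (g : riemannian_metric A) (x : M -> 'rV[R]_m) :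
  connected [set: M] ->
  isometric_immersion g x ->
  parallel_mean_curvature_vector g x ->
  (homothetic g (laplace_map g x) <->
   exists (a : 'rV[R]_m) (r : R), 0 < r /\ minimal_in_hypersphere g x a r).
Proof.
move=> cM x_iso Hpar; split => [hom|[a [r [r0 [xar min]]]]].
(* If [M] is empty any sphere will do; otherwise a point serves to name the centre. *)
- have [[p0 _]|M0] := pselect (exists p : M, True); last first.
    exists 0, 1; split; first exact: ltr01.
    by split=> p; case: M0; exists p.
  have [lam lam0 cst] :=
    homothetic_position_mean_curvature n_gt0 x_iso cM Hpar hom.
  pose H := mean_curvature_vector g x.
  pose a := x p0 + lam^-1 *: H p0.
  have lamn0 : lam != 0 by rewrite gt_eqF.
  have xaE p : x p - a = - (lam^-1 *: H p).
    by rewrite /a -(cst p) opprD addrA subrr add0r.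
  have radial p := sphere_mean_curvature_vectorE n_gt0 x_iso (y := a) (p := p).
  have HE p : H p = - (lam *: (x p - a)).
    by rewrite xaE scalerN opprK scalerA mulfV// scale1r.
  have {}radial p : dotp (x p - a) (x p - a) = lam^-1 /\
      let i := chart_at A p in
      sphere_mean_curvature a (metric g i) (x \o param i) (chart i p) = 0.
    have [|m1 sE] := radial p.
      move=> u Uu b; rewrite [X in dotp X _]xaE dotpNl dotpZl.
      rewrite -[H _]/((H \o param _) u).
      rewrite -(mean_curvature_vector_param x_iso Uu).
      rewrite (mean_curvature_normal (immersion_smooth x_iso _)
        (immersion_metric x_iso (i := _)) (metric_posdef g (i := _)) b Uu).
      by rewrite mulr0 oppr0.
    (* The product of [H p] and [x p - a] is -1, and [H p] is [- lam] times [x p - a]; this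
       determines the radius. *)
    have xa2 : dotp (x p - a) (x p - a) = lam^-1.
      move: m1; rewrite -/(H p) HE dotpNl dotpZl => /oppr_inj.
      by move=> E; apply: (mulfI lamn0); rewrite E mulfV.
    split => //; rewrite /= sE xa2 invrK -/(H p) HE addNr//.
  have l0 : 0 < lam^-1 by rewrite invr_gt0.
  exists a, (Num.sqrt lam^-1); split; first by rewrite sqrtr_gt0.
  split=> p; last by have [_] := radial p.
  by rewrite /hypersphere/= sqr_sqrtr ?(ltW l0)//; have [] := radial p.
(* Minimality means [H = - (x - a) / r^2], so the Laplace map [- n H] is [k] times [x - a], and [k]
   is the homothety ratio. *)
- pose k := n%:R / r ^+ 2.
  have r20 : r ^+ 2 != 0 by rewrite expf_neq0// gt_eqF.
  have LE p : laplace_map g x p = k *: (x p - a).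
    rewrite (laplace_mapE n_gt0 x_iso).
    have [|_ sE] := sphere_mean_curvature_vectorE n_gt0 x_iso (y := a) (p := p).
      set i := chart_at A p => u Uu b.
      have sx := immersion_smooth x_iso i.
      have dx : derivable (x \o param i) u b := smooth_derivable sx Uu.
      have dxa : derivable (fun v => (x \o param i) v - a) u b.
        exact: (derivableB dx (derivable_cst a u b)).
      have DxaE :
          'D_b (fun v => (x \o param i) v - a) u = 'D_b (x \o param i) u.
        apply: (etrans (deriveB dx (derivable_cst a u b))).
        by rewrite derive_cst subr0.
      (* Differentiating the equation of the sphere shows that twice the product of [x - a] with a
         tangent vector is zero. *)
      have := @dotp_cst_derive _ _ _ _ (@chart_open _ _ _ A i) _ _ u b
        (r ^+ 2) Uu (fun v _ => xar (param i v)) dxa dxa.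
      rewrite DxaE dotpC => /eqP; rewrite -addr_eq0 -mulr2n mulrn_eq0/=.
      by move/eqP.
    move: (min p); rewrite /= sE (xar p) => /eqP; rewrite addr_eq0 => /eqP ->.
    by rewrite scalerN opprK scalerA.
  exists k; first by rewrite divr_gt0// ?exprn_gt0// ltr0n.
  move=> i p ip X Y.
  have Up : (chart i @` dom i) (chart i p) by exists p.
  have sx := immersion_smooth x_iso i.
  have dx := smooth_differentiable sx Up.
  have DL Z : tangent_map (laplace_map g x) i p Z =
      k *: 'D_Z (x \o param i) (chart i p).
    rewrite /tangent_map.
    have -> : laplace_map g x \o param i = k *: ((x \o param i) - cst a).
      by apply/funext => u; rewrite /= LE.
    have dxa : differentiable ((x \o param i) - cst a) (chart i p).
      exact: differentiableB.
    rewrite -deriveE; last exact: differentiableZ.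
    rewrite deriveZ; last exact: diff_derivable.
    rewrite deriveB; [|exact: diff_derivable|exact: derivable_cst].
    by rewrite derive_cst subr0.
  by rewrite !DL dotpZl dotpZr mulrA -expr2 (immersion_metric x_iso Up).
Qed.
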